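(* Let $N$ be a positive integer. The field $K_N=\mathbb{Q}(\zeta_N)$ is not unit reducible if $N$ is divisible by $2^4$, $3^3$, $5^2$, $7^2$, $11^2$ or any prime $p\ge 13$.
   Context: For a positive integer $N$, $\zeta_N=\exp(2\pi i/N)$ and $K_N=\mathbb{Q}(\zeta_N)$. For $K=K_N$, $\mathcal{O}_K$ is the ring of integers, $\mathcal{O}_K^*$ the unit group, and $*$ denotes complex conjugation (the identity if $K=\mathbb{Q}$). An element $a\in K$ is totally positive if $\sigma(a)\in\mathbb{R}_{>0}$ for every embedding $\sigma:K\to\mathbb{C}$; $K_{>>0}$ is the set of totally positive elements. For $a\in K_{>>0}$ define $\mu(a)=\min_{x\in\mathcal{O}_K\setminus\{0\}}\mathrm{Tr}_{K/\mathbb{Q}}(axx^* )$ and $\mu^*(a)=\min_{u\in\mathcal{O}_K^*}\mathrm{Tr}_{K/\mathbb{Q}}(auu^* )$. $K$ is unit reducible if $\mu(a)=\mu^*(a)$ for all $a\in K_{>>0}$. *)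

(* Defs.v *)
From HB Require Import structures.
From mathcomp Require Import all_boot all_order all_algebra all_field.
From mathcomp Require Import ring lra.

Set Implicit Arguments.
Unset Strict Implicit.
Unset Printing Implicit Defensive.

Import Order.TTheory GRing.Theory Num.Theory.
Local Open Scope ring_scope.

(* [N.-root (-1)] is the [N]-th root of [-1] of least non-negative argument,
   i.e. exp(pi i / N); its square is zeta_N = exp(2 pi i / N). *)
Definition zeta (N : nat) : algC := (N.-root (-1)) ^+ 2.

Definition cyclo (N : nat) : fieldExtType rat :=
  tag (num_field_exists [:: zeta N]).

Definition cyclo_incl (N : nat) : {rmorphism cyclo N -> algC} :=
  tag (tagged (num_field_exists [:: zeta N])).

Lemma cyclo_gen (N : nat) :
  exists2 z : cyclo N, cyclo_incl N z = zeta N & <<1; z>>%VS = fullv.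
Proof.
rewrite /cyclo_incl /cyclo.
case: (num_field_exists _) => Qs [QsC [[|z [|z' s]] //= [Dz] genz]].
by exists z; rewrite // -adjoin_seq1.
Qed.

Section ZetaPrimitive.

Lemma norm_root1 m (x : algC) : (0 < m)%N -> x ^+ m = 1 -> `|x| = 1.
Proof.
move=> m_gt0 xm1; apply/eqP; rewrite -(@pexpr_eq1 _ _ m) ?normr_ge0 //.
by rewrite -normrX xm1 normr1.
Qed.

Lemma ReIm1 (x : algC) : `|x| = 1 -> 'Re x ^+ 2 + 'Im x ^+ 2 = 1.
Proof. by move=> x1; rewrite -normC2_Re_Im x1 expr1n. Qed.

Lemma Re_mul_conj (x y : algC) :
  'Re (x * y^*) = 'Re x * 'Re y + 'Im x * 'Im y.
Proof. by rewrite ReM Re_conj Im_conj mulrN opprK. Qed.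

(* cos (x - y) > cos x for 0 < y <= x <= pi, with c = cos x, d = cos y. *)
Lemma cos_sub_gt (F : realFieldType) (c s d t : F) :
  c ^+ 2 + s ^+ 2 = 1 -> d ^+ 2 + t ^+ 2 = 1 -> 0 <= s -> 0 <= t ->
  c <= d -> d < 1 -> c < c * d + s * t.
Proof.
move=> cs dt s0 t0 cd d1.
have [c_lt0|c_gt0|c0] := ltgtP c 0.
- have st : 0 <= s * t by rewrite mulr_ge0.
  nra.
- suff : c * (1 - d) < s * t by lra.
  have e : 0 < (1 - d) by lra.
  rewrite -(ltr_pXn2r (n := 2)) ?nnegrE ?mulr_ge0 ?(ltW c_gt0) ?(ltW e) //.
  rewrite !exprMn.
  have -> : s ^+ 2 = (1 - c) * (1 + c) by rewrite -subr_sqr expr1n -cs addrC addKr.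
  have -> : t ^+ 2 = (1 - d) * (1 + d) by rewrite -subr_sqr expr1n -dt addrC addKr.
  have g : 0 < (1 + d - 2 * c ^+ 2).
    have : 0 < (1 - c) * (1 + 2 * c) by apply: mulr_gt0; lra.
    lra.
  have := mulr_gt0 e g; lra.
- rewrite c0 mul0r add0r in cs cd *.
  apply: mulr_gt0; rewrite lt_neqAle ?s0 ?t0 andbT eq_sym.
    by apply/eqP=> s00; move: cs; rewrite s00; lra.
  by apply/eqP=> t00; move: dt; rewrite t00; nra.
Qed.

Lemma Re_mul_conj_gt (x y : algC) : `|x| = 1 -> `|y| = 1 -> y != 1 ->
  0 <= 'Im x -> 0 <= 'Im y -> 'Re x <= 'Re y -> 'Re x < 'Re (x * y^*).
Proof.
move=> x1 y1 yn1 sx sy cxy; rewrite Re_mul_conj.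
pose r (z : algC) := in_algR (Creal_Re z); pose i (z : algC) := in_algR (Creal_Im z).
have R1 z : `|z| = 1 -> r z ^+ 2 + i z ^+ 2 = 1.
  by move=> z1; apply: val_inj; rewrite /= -[RHS](ReIm1 z1).
have Rd : r y < 1.
  have := R1 y y1; rewrite lt_neqAle => Ry; apply/andP; split; last by nra.
  apply: contraNneq yn1 => ry1; move: Ry; rewrite ry1 => Ry.
  have /eqP : i y ^+ 2 = 0 by lra.
  rewrite sqrf_eq0 => /eqP iy0.
  have /(congr1 val)/= ry := ry1; have /(congr1 val)/= iy := iy0.
  by rewrite [y]Crect ry iy mulr0 addr0.
exact: (@cos_sub_gt _ (r x) (i x) (r y) (i y) (R1 x x1) (R1 y y1) sx sy cxy Rd).
Qed.

Lemma zeta_prim (N : nat) : (0 < N)%N -> N.-primitive_root (zeta N).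
Proof.
move=> N_gt0.
have [->|N_neq1] := eqVneq N 1%N.
  by rewrite /zeta root1C sqrrN expr1n; apply/andP; split => //; 
     apply/forallP=> -[[|i] //= _]; rewrite unity_rootE expr1n !eqxx.
have N_gt1 : (1 < N)%N by case: N N_gt0 N_neq1 => [|[]].
pose M := N.*2; have M_gt0 : (0 < M)%N by rewrite double_gt0.
have [e e_prim] := C_prim_root_exists M_gt0.
pose w : algC := N.-root (-1).
have wN : w ^+ N = -1 by rewrite rootCK.
have ImW : 0 <= 'Im w by rewrite Im_rootC_ge0.
have unitM (x : algC) : x ^+ M = 1 -> exists i : 'I_M, x = e ^+ i.
  by move=> /(prim_rootP e_prim) [i ->]; exists i.
have n1 (x : algC) : x ^+ M = 1 -> `|x| = 1 by exact: norm_root1.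
have wM : w ^+ M = 1 by rewrite /M -muln2 exprM wN sqrrN expr1n.
have extr (P : pred algC) : (exists2 x, x ^+ M = 1 & P x) ->
    (forall x, P x -> P x^*) ->
  exists g, [/\ g ^+ M = 1, P g, 0 <= 'Im g &
     forall x, x ^+ M = 1 -> P x -> 'Re x <= 'Re g].
  move=> [x0 x0M Px0] Pconj.
  have [i0 Di0] := unitM x0 x0M.
  pose r (i : 'I_M) := in_algR (Creal_Re (e ^+ i)).
  have Pi0 : P (e ^+ i0) by rewrite -Di0.
  have [j Pj maxj] := @Order.TotalTheory.arg_maxP _ algR 'I_M i0 (fun i => P (e ^+ i)) r Pi0.
  have eM (i : 'I_M) : (e ^+ i) ^+ M = 1 by rewrite exprAC (prim_expr_order e_prim) expr1n.
  have mx x : x ^+ M = 1 -> P x -> 'Re x <= 'Re (e ^+ j).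
    by move=> xM Px; have [i Di] := unitM x xM; rewrite Di in Px *; apply: (maxj i Px).
  have [Im_ge0|] := real_leP (@real0 algC) (Creal_Im (e ^+ j)).
    by exists (e ^+ j).
  move=> Im_lt0; exists (e ^+ j)^*; split=> //.
  - by rewrite -rmorphXn /= eM rmorph1.
  - exact: Pconj.
  - by rewrite Im_conj oppr_ge0 ltW.
  by move=> x xM Px; rewrite Re_conj mx.
have conj1 (x : algC) : (x^* == 1) = (x == 1).
  by rewrite -(inj_eq (inv_inj conjCK)) conjCK conjC1.
have [||g [gM gn1 Img maxg]] := extr (fun x => x != 1).
- exists e; first exact: prim_expr_order.
  rewrite -[e]expr1 -(prim_order_dvd e_prim) dvdn1 /M.
  by case: (N) N_gt1 => [|[]].
- by move=> x; rewrite conj1.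
have gC : g^* = g^-1 by rewrite invC_norm (n1 g gM) expr1n invr1 mul1r.
have gU : g != 0 by rewrite -normr_eq0 (n1 g gM) oner_eq0.
have gCX : g^* = g ^+ M.-1.
  by apply: (mulfI gU); rewrite gC mulfV // -exprS prednK.
have genS x : x ^+ M = 1 -> x \in [seq g ^+ i | i <- iota 0 M].
  move=> xM; apply/contraT=> xS.
  pose P (x : algC) := x \notin [seq g ^+ i | i <- iota 0 M].
  have powS k : g ^+ k \in [seq g ^+ i | i <- iota 0 M].
    apply/mapP; exists (k %% M)%N; last by rewrite expr_mod.
    by rewrite mem_iota ltn_mod M_gt0.
  have [||h [hM Ph Imh maxh]] := extr P; first by exists x.
    move=> y; apply: contra => /mapP[k _ Dy].
    by rewrite -[y]conjCK Dy rmorphXn /= gCX -exprM powS.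
  have hn1 : h != 1 by apply: contraNneq Ph => ->; rewrite -(expr0 g) powS.
  have Pk : P (h * g^*).
    apply: contra Ph => /mapP[k _ Dk].
    by rewrite -[h](mulfVK gU) -gC Dk -exprSr powS.
  have kM : (h * g^*) ^+ M = 1.
    by rewrite exprMn hM mul1r -rmorphXn /= gM rmorph1.
  have := Re_mul_conj_gt (n1 h hM) (n1 g gM) gn1 Imh Img (maxg h hM hn1).
  by move/lt_geF; rewrite maxh.
have [m g_prim m_dvd] := prim_order_exists M_gt0 gM.
have Dm : m = M.
  have [i _ Di] := mapP (genS e (prim_expr_order e_prim)).
  apply/eqP; rewrite eqn_dvd m_dvd (prim_order_dvd e_prim).
  by rewrite Di exprAC (prim_expr_order g_prim) expr1n eqxx.
rewrite {m m_dvd}Dm in g_prim.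
have gN : g ^+ N = -1.
  have /eqP : (g ^+ N) ^+ 2 = 1 by rewrite -exprM muln2.
  rewrite sqrf_eq1 => /orP[|/eqP //].
  rewrite -(prim_order_dvd g_prim) => /(dvdn_leq N_gt0).
  by rewrite /M -addnn -{3}[N]addn0 leq_add2l leqNgt N_gt0.
have wn1 : w != 1.
  apply: contra_eqN wN => /eqP->; rewrite expr1n -subr_eq0 opprK.
  by rewrite -[1 + 1]/(2%:R) pnatr_eq0.
have Dw : w = g.
  have eR : 'Re w = 'Re g.
    apply/le_anti; rewrite (maxg w wM wn1) /=; exact: rootC_Re_max.
  rewrite [w]Crect [g]Crect eR; congr (_ + 'i * _); apply/eqP.
  rewrite -(@eqrXn2 _ 2) //; apply/eqP/(addrI ('Re w ^+ 2)).
  by rewrite (ReIm1 (n1 w wM)) eR (ReIm1 (n1 g gM)).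
rewrite /zeta -/w Dw.
have -> : N = (M %/ gcdn 2 M)%N by rewrite (gcdn_idPl _) /M -muln2 ?dvdn_mull ?mulnK.
exact: exp_prim_root.
Qed.

End ZetaPrimitive.

Lemma cyclo_conj_subproof (N : nat) (x : cyclo N) :
  exists y, cyclo_incl N y == (cyclo_incl N x)^*.
Proof.
have [z Dz genz] := cyclo_gen N.
have zC : (zeta N)^* = (zeta N)^-1.
  have [->|N_gt0] := posnP N; first by rewrite /zeta root0C expr0n invr0 conjC0.
  have zN := prim_expr_order (zeta_prim N_gt0).
  by rewrite invC_norm (norm_root1 N_gt0 zN) expr1n invr1 mul1r.
have /Fadjoin1_polyP[p ->] : x \in <<1; z>>%VS by rewrite genz memvf.
exists (map_poly (in_alg (cyclo N)) p).[z^-1]; apply/eqP.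
rewrite -!horner_map /= fmorphV /= Dz zC -!map_poly_comp; congr _.[_].
by apply: eq_map_poly => a /=; rewrite alg_num_field !fmorph_rat.
Qed.

Definition cyclo_conj (N : nat) (x : cyclo N) : cyclo N :=
  xchoose (cyclo_conj_subproof x).

Lemma cyclo_conjE (N : nat) (x : cyclo N) :
  cyclo_incl N (cyclo_conj x) = (cyclo_incl N x)^*.
Proof. exact/eqP/(xchooseP (cyclo_conj_subproof x)). Qed.

Section NumberField.

Variable K : fieldExtType rat.
Implicit Types a x u : K.

Definition is_integer x : Prop := integralOver (intr : int -> K) x.

Definition is_unit_integer u : Prop :=
  is_integer u /\ exists2 v, is_integer v & u * v = 1.

(* Trace of the [rat]-linear endomorphism [x |-> a * x], computed in the basis
   [vbasis {:K}]. *)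
Definition field_trace a : rat :=
  \sum_(i < \dim {:K}) coord (vbasis {:K}) i (a * (vbasis {:K})`_i).

(* On [algC], [0 < z] entails that [z] is real.  Every embedding of [K] in the
   complex numbers takes its values in [algC]. *)
Definition totally_positive a : Prop :=
  forall sigma : {rmorphism K -> algC}, 0 < sigma a.

End NumberField.

Definition is_min (S : rat -> Prop) (m : rat) : Prop :=
  S m /\ forall r, S r -> m <= r.

Section UnitReducible.

Variable N : nat.
Implicit Type a : cyclo N.

Definition trace_form a (x : cyclo N) : rat :=
  field_trace (a * x * cyclo_conj x).

(* [is_mu a m] means mu(a) = m, and [is_mu_star a m] means mu^*(a) = m. *)
Definition is_mu a : rat -> Prop :=
  is_min (fun r => exists x, [/\ is_integer x, x != 0 & r = trace_form a x]).

Definition is_mu_star a : rat -> Prop :=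
  is_min (fun r => exists u, is_unit_integer u /\ r = trace_form a u).

(* Both minima exist for totally positive [a]: the values of [trace_form a] on
   nonzero integers are positive rationals with a common denominator. *)
Definition unit_reducible : Prop :=
  forall a, totally_positive a ->
  forall m m' : rat, is_mu a m -> is_mu_star a m' -> m = m'.

End UnitReducible.

(* Main.v *)
From HB Require Import structures.
Require Import Defs.
From mathcomp Require Import all_boot all_order all_algebra all_field all_solvable.
From mathcomp Require Import ring zify.

(* Write N = M q with q = p^(k+1) and p^k (p + 1) > 12, put xi = zeta_N^M, a
   primitive q-th root of unity, and take a = 1/(x x^* ) with x = 1 - xi.  Then
   Tr(a x x^* ) = phi(N), whereas Tr(a y y^* ) >= p^k (p + 1)/12 * phi(N) for every
   integer y which is not a multiple of 1 - xi, in particular for every unit.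

   For M = 1 the lower bound comes from an expansion y/(1 - xi) = sum_n (y_n/p) xi^n
   with integers y_n such that y_n, y_(n + p^k), ..., y_(n + (p-1) p^k) are distinct
   modulo p: the trace form is a sum of squares of differences of such y_n, and
   distinct integers are at least as spread out as consecutive ones.  A prime
   factor r of M is removed by writing y = sum_(i < r) zeta^i y_i over the field of
   (M/r) q-th roots of unity: the relative trace of y y^* is r sum_i y_i y_i^* in the
   ramified case and sum_(i < j) |y_i - y_j|^2, after twisting the y_i, in the
   unramified one, and enough of the terms are not multiples of 1 - xi.

   All this is done for y in Z[zeta_N], which is the full ring of integers: if
   r y = w lies in Z[zeta_N] for a prime r and an integer y, divide out by pi = r,
   or by pi = 1 - zeta_(r^e) if r^e is the exact power of r in N, one factor at a
   time.  Integrality of y puts a power of w in (pi); but Z[zeta_N]/(pi) is fixed by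
   some power of the Frobenius map, so w itself is in (pi). *)

Set Implicit Arguments.
Unset Strict Implicit.
Unset Printing Implicit Defensive.

Import Order.TTheory GRing.Theory Num.Theory.
Local Open Scope ring_scope.

(** * Splitting sums and polynomials by residues of the index *)

Lemma sum_ord_mul (V : nmodType) (n r : nat) (G : nat -> V) :
  \sum_(j < n * r) G j = \sum_(j < n) \sum_(l < r) G (j + n * l)%N.
Proof.
rewrite exchange_big /= -(big_mkord xpredT G) mulnC big_nat_mul big_mkord.
apply: eq_bigr => l _; rewrite mulSn -{1}[(l * n)%N]add0n big_addn addnK.
by rewrite big_mkord; apply: eq_bigr => j _; rewrite mulnC.
Qed.

Lemma poly_split (R : comNzRingType) (r : nat) (f : {poly R}) : (0 < r)%N ->
  exists g : nat -> {poly R}, f = \sum_(i < r) 'X^i * (g i \Po 'X^r).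
Proof.
move=> r_gt0; pose m := size f.
exists (fun i => \sum_(n < m | (n %% r == i)%N) f`_n *: 'X^(n %/ r)).
pose h (n : 'I_m) : 'I_r := Ordinal (ltn_pmod n r_gt0).
rewrite -{1}[f]coefK poly_def (partition_big h xpredT) //=.
apply: eq_bigr => i _.
rewrite raddf_sum /= mulr_sumr; apply: eq_big => [n|n /eqP<-] //=.
rewrite comp_polyZ rmorphXn /= comp_polyX -scalerAr -exprM -exprD; congr (_ *: 'X^_).
by rewrite mulnC addnC -divn_eq.
Qed.

(** * Sums over primitive roots of unity *)

Section Parseval.

Implicit Types (z w x : algC).

Lemma normr_prim_root n z : n.-primitive_root z -> `|z| = 1.
Proof.
by move=> z_prim; apply: norm_root1 (prim_order_gt0 z_prim) (prim_expr_order z_prim).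
Qed.

Lemma conj_norm1 z : `|z| = 1 -> z^* = z^-1.
Proof. by move=> z1; rewrite invC_norm z1 expr1n invr1 mul1r. Qed.

Lemma sum_root_unity r x : x ^+ r = 1 -> x != 1 -> \sum_(l < r) x ^+ l = 0.
Proof.
move=> xr x1; apply: (@mulfI _ (x - 1)); first by rewrite subr_eq0.
by rewrite -subrX1 xr subrr mulr0.
Qed.

(** Once the squares are expanded, the pair [i], [i'] carries a full geometric sum of powers of
    [w ^+ i / w ^+ i'], which vanishes off the diagonal. *)
Lemma parseval r w (a : nat -> algC) : r.-primitive_root w ->
  \sum_(l < r) `|\sum_(i < r) a i * w ^+ (i * l)| ^+ 2
  = r%:R * \sum_(i < r) `|a i| ^+ 2.
Proof.
move=> w_prim; have r_gt0 := prim_order_gt0 w_prim.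
have w0 : w != 0 by rewrite -normr_eq0 (normr_prim_root w_prim) oner_eq0.
have wC := conj_norm1 (normr_prim_root w_prim).
transitivity (\sum_(i < r) \sum_(i' < r) \sum_(l < r)
     a i * (a i')^* * (w ^+ i / w ^+ i') ^+ l).
  rewrite [RHS](eq_bigr _ (fun i _ => exchange_big _ _ _ _ _ _)) exchange_big /=.
  apply: eq_bigr => l _; rewrite normCK rmorph_sum mulr_suml.
  apply: eq_bigr => i _; rewrite mulr_sumr; apply: eq_bigr => i' _.
  rewrite rmorphM rmorphXn /= wC exprMn -!exprM mulrACA; congr (_ * (_ * _)).
  by rewrite !exprVn -!exprM.
rewrite mulr_sumr; apply: eq_bigr => i _.
rewrite (bigD1 i) //= [X in _ + X]big1 ?addr0 => [|i' ni].
  rewrite divff ?expf_neq0 //.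
  under eq_bigr => l _ do rewrite expr1n mulr1.
  by rewrite sumr_const card_ord -normCK mulr_natl.
rewrite -mulr_sumr sum_root_unity ?mulr0 //.
  by rewrite expr_div_n (exprAC w i) (exprAC w i') (prim_expr_order w_prim) !expr1n divr1.
apply: contra ni => /eqP e.
have /eqP : w ^+ i = w ^+ i' by rewrite -[LHS](divfK (expf_neq0 i' w0)) e mul1r.
by rewrite (eq_prim_root_expr w_prim) !modn_small // eq_sym.
Qed.

(** Applied to a Parseval sum from which the term at one root of unity is removed: what is left
    depends only on differences of the coefficients. *)
Lemma sum_sqr_diff r (a : nat -> algC) :
  r%:R * (\sum_(i < r) `|a i| ^+ 2) - `|\sum_(i < r) a i| ^+ 2
  = 2^-1 * \sum_(i < r) \sum_(i' < r) `|a i - a i'| ^+ 2.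
Proof.
apply: (canRL (mulKf _)); first by rewrite pnatr_eq0.
have -> : \sum_(i < r) \sum_(i' < r) `|a i - a i'| ^+ 2 =
  \sum_(i < r) \sum_(i' < r) (`|a i| ^+ 2 + `|a i'| ^+ 2)
  - (\sum_(i < r) \sum_(i' < r) (a i * (a i')^* + a i' * (a i)^*)).
  rewrite -sumrB; apply: eq_bigr => i _; rewrite -sumrB; apply: eq_bigr => i' _.
  by rewrite !normCK rmorphB; ring.
have -> : \sum_(i < r) \sum_(i' < r) (`|a i| ^+ 2 + `|a i'| ^+ 2)
  = 2 * (r%:R * \sum_(i < r) `|a i| ^+ 2).
  under eq_bigr => i _ do rewrite big_split sumr_const card_ord -mulr_natl /=.
  rewrite big_split /= -mulr_sumr [X in _ + X]sumr_const card_ord -mulr_natl.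
  by rewrite mulr1 -[X in _ + X]mulr_natl [RHS]mulr_natl mulr2n.
have -> : \sum_(i < r) \sum_(i' < r) (a i * (a i')^* + a i' * (a i)^*)
  = 2 * `|\sum_(i < r) a i| ^+ 2; last by ring.
have e : \sum_(i < r) \sum_(i' < r) a i * (a i')^* = `|\sum_(i < r) a i| ^+ 2.
  rewrite normCK rmorph_sum mulr_suml; apply: eq_bigr => i _.
  by rewrite mulr_sumr.
under eq_bigr => i _ do rewrite big_split.
rewrite big_split /= [X in _ + X]exchange_big /= e; ring.
Qed.

End Parseval.

(** For a primitive [N]-th root [z] the points are the Galois conjugates of [z], so this stands for
    the trace from the cyclotomic field to the rationals. *)
Definition psum (N : nat) (z : algC) (F : algC -> algC) : algC :=
  \sum_(j < N | coprime j N) F (z ^+ j).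

Lemma eq_psum N z (F G : algC -> algC) :
  (forall j : nat, coprime j N -> F (z ^+ j) = G (z ^+ j)) -> psum N z F = psum N z G.
Proof. by move=> FG; apply: eq_bigr => j /FG. Qed.

Lemma psum_ge0 N z (F : algC -> algC) :
  (forall j : nat, 0 <= F (z ^+ j)) -> 0 <= psum N z F.
Proof. by move=> F0; apply: sumr_ge0. Qed.

Lemma psum1 N z : psum N z (fun=> 1) = (totient N)%:R.
Proof.
rewrite /psum totient_count_coprime big_mkord natr_sum big_mkcond.
by apply: eq_bigr => j _; rewrite coprime_sym; case: (coprime _ _).
Qed.

Lemma psum_mul N r z F :
  psum (N * r) z F = \sum_(j < N | coprime j N)
     \sum_(l < r | coprime (j + N * l) r) F (z ^+ (j + N * l)).
Proof.
rewrite /psum big_mkcond 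
  (sum_ord_mul N r (fun j => if coprime j (N * r) then F (z ^+ j) else 0)).
rewrite [RHS]big_mkcond; apply: eq_bigr => j _.
have co (l : nat) : coprime (j + N * l) N = coprime j N.
  by rewrite /coprime mulnC addnC gcdnC gcdnMDl gcdnC.
case: ifP => co_j.
  by rewrite [RHS]big_mkcond; apply: eq_bigr => l _; rewrite coprimeMr co co_j.
by rewrite big1 // => l _; rewrite coprimeMr co co_j.
Qed.

(** * Descent from [N * r]-th to [N]-th roots of unity *)

Section Descent.

Variables (N r : nat) (z : algC) (W : algC -> algC).
Variables (F : algC -> algC) (G : nat -> algC -> algC).
Hypothesis z_prim : (N * r).-primitive_root z.
Hypothesis FG : forall x, F x = \sum_(i < r) x ^+ i * G i (x ^+ r).

Let Nr_gt0 : (0 < N * r)%N. Proof. exact: prim_order_gt0 z_prim. Qed.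
Let N_gt0 : (0 < N)%N. Proof. by move: Nr_gt0; rewrite muln_gt0 => /andP[]. Qed.
Let r_gt0 : (0 < r)%N. Proof. by move: Nr_gt0; rewrite muln_gt0 => /andP[]. Qed.

Lemma zN_prim : r.-primitive_root (z ^+ N).
Proof.
by have := dvdn_prim_root z_prim (dvdn_mull N (dvdnn r)); rewrite mulnK.
Qed.

Lemma zr_prim : N.-primitive_root (z ^+ r).
Proof.
by have := dvdn_prim_root z_prim (dvdn_mulr r (dvdnn N)); rewrite mulKn.
Qed.

(** For fixed [j] the points [z ^+ (j + N * l)] with [l < r] form a fibre of the [r]-th power map; a
    weight depending on [w ^+ r] is constant on it. *)
Lemma weight_shift (j l : nat) : (z ^+ (j + N * l)) ^+ r = (z ^+ r) ^+ j.
Proof.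
rewrite -!exprM mulnDl mulnAC exprD [(r * j)%N]mulnC.
by rewrite (exprM z (N * r)) (prim_expr_order z_prim) expr1n mulr1.
Qed.

(** On a fibre the decomposition of [F] is a Fourier sum in [l]; the factors [z ^+ (j * i)] of its
    coefficients have norm 1 and disappear. *)
Lemma parseval_shift (j : nat) :
  \sum_(l < r) `|F (z ^+ (j + N * l))| ^+ 2 =
  r%:R * \sum_(i < r) `|G i ((z ^+ r) ^+ j)| ^+ 2.
Proof.
have z1 := normr_prim_root z_prim.
transitivity (r%:R * \sum_(i < r) `|z ^+ (j * i) * G i ((z ^+ r) ^+ j)| ^+ 2).
  rewrite -(parseval (fun i => z ^+ (j * i) * G i ((z ^+ r) ^+ j)) zN_prim).
  apply: eq_bigr => l _; congr (`|_| ^+ 2); rewrite FG; apply: eq_bigr => i _.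
  rewrite weight_shift.
  rewrite -!exprM mulrAC -exprD; congr (z ^+ _ * _).
  by rewrite mulnDl [(i * l)%N]mulnC mulnA.
congr (_ * _); apply: eq_bigr => i _.
by rewrite normrM normrX z1 expr1n mul1r.
Qed.

(** All points of a fibre over a primitive [N]-th root are primitive, so Parseval applies to whole
    fibres. *)
Lemma psum_ramified : (forall m : nat, coprime m N -> coprime m r) ->
  psum (N * r) z (fun w => `|F w| ^+ 2 * W (w ^+ r))
  = r%:R * \sum_(i < r) psum N (z ^+ r) (fun w => `|G i w| ^+ 2 * W w).
Proof.
move=> co; rewrite psum_mul exchange_big mulr_sumr /=; apply: eq_bigr => j co_j.
have co_jl (l : nat) : coprime (j + N * l) r.
  by apply: co; rewrite /coprime mulnC addnC gcdnC gcdnMDl gcdnC.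
rewrite (eq_bigl xpredT) => [|l]; last exact: co_jl.
under eq_bigr => l _ do rewrite weight_shift.
by rewrite -mulr_suml parseval_shift -mulr_suml mulrA.
Qed.

(* Among the [r]-th roots [w] of [x], the only one which is not a primitive
   [N * r]-th root of unity is [x ^+ rho]. *)
Lemma psum_unramified (rho : nat) : prime r -> r * rho = 1 %[mod N] ->
  psum (N * r) z (fun w => `|F w| ^+ 2 * W (w ^+ r))
  = 2^-1 * \sum_(i < r) \sum_(i' < r) psum N (z ^+ r)
      (fun w => `|w ^+ (rho * i) * G i w - w ^+ (rho * i') * G i' w| ^+ 2 * W w).
Proof.
move=> r_pr rhoE; rewrite psum_mul.
under [in RHS]eq_bigr => i _ do rewrite exchange_big.
rewrite exchange_big mulr_sumr /=; apply: eq_bigr => j co_j.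
set x := (z ^+ r) ^+ j.
have xN : x ^+ N = 1.
  by rewrite exprAC (prim_expr_order zr_prim) expr1n.
have x1 : `|x| = 1 by rewrite !normrX (normr_prim_root z_prim) !expr1n.
have rho1 y : y ^+ N = 1 -> y ^+ (r * rho) = y.
  by move=> yN; rewrite -(expr_mod _ yN) rhoE (expr_mod _ yN) expr1.
have z0 : z != 0 by rewrite -normr_eq0 (normr_prim_root z_prim) oner_eq0.
have [l0 Dl0] : exists l0 : 'I_r, x ^+ rho = z ^+ (j + N * l0).
  have [|l0 Dl0] := prim_rootP zN_prim (x := x ^+ rho / z ^+ j).
    rewrite expr_div_n -exprM mulnC rho1 // /x.
    by rewrite exprAC divff // !expf_neq0.
  by exists l0; rewrite exprD exprM -Dl0 mulrC divfK // expf_neq0.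
have co_l (l : 'I_r) : coprime (j + N * l) r = (l != l0).
  rewrite coprime_sym prime_coprime //; congr (~~ _).
  rewrite -(@dvdn_pmul2r N) // [(r * N)%N]mulnC (prim_order_dvd z_prim) exprM.
  transitivity (z ^+ (j + N * l) == x ^+ rho).
    apply/eqP/eqP => [/rho1 <-|->]; first by rewrite exprM weight_shift.
    by rewrite exprAC xN expr1n.
  rewrite Dl0 !exprD (inj_eq (mulfI (expf_neq0 j z0))) !exprM.
  by rewrite (eq_prim_root_expr zN_prim) !modn_small.
rewrite (eq_bigl _ _ co_l).
under eq_bigr => l _ do rewrite weight_shift -/x.
rewrite -mulr_suml.
(* Parseval over the whole fibre, minus the excluded root [x ^+ rho], at which [F] is the twisted
   sum of its components. *)
have -> : \sum_(l < r | l != l0) `|F (z ^+ (j + N * l))| ^+ 2 =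
    r%:R * (\sum_(i < r) `|x ^+ (rho * i) * G i x| ^+ 2)
    - `|\sum_(i < r) x ^+ (rho * i) * G i x| ^+ 2.
  have := parseval_shift j; rewrite (bigD1 l0) //= -Dl0 => /(canRL (addKr _)) ->.
  rewrite addrC; congr (_ * _ - _).
    by apply: eq_bigr => i _; rewrite normrM normrX x1 expr1n mul1r.
  rewrite FG; congr (`|_| ^+ 2); apply: eq_bigr => i _.
  by rewrite -[(x ^+ rho) ^+ r]exprM [(rho * r)%N]mulnC rho1 // exprM.
rewrite (sum_sqr_diff r (fun i => x ^+ (rho * i) * G i x)) -mulrA; congr (_ * _).
rewrite mulr_suml; apply: eq_bigr => i _; rewrite mulr_suml; apply: eq_bigr => i' _.
by [].
Qed.

End Descent.

(** * Distinct integers are spread out *)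

Lemma sum_sqr_diff_ord (n : nat) :
  6 * \sum_(i < n) \sum_(j < n) (i%:R - j%:R) ^+ 2
  = n%:R ^+ 2 * (n%:R ^+ 2 - 1) :> int.
Proof.
have inner (m : nat) (x : int) : 6 * \sum_(j < m) (x - j%:R) ^+ 2 =
    6 * m%:R * x ^+ 2 - 6 * x * m%:R * (m%:R - 1)
      + m%:R * (m%:R - 1) * (2 * m%:R - 1).
  elim: m => [|m IHm]; first by rewrite big_ord0; ring.
  by rewrite big_ord_recr /= mulrDr IHm -[m.+1]addn1 natrD; ring.
rewrite mulr_sumr; under eq_bigr => i _ do rewrite inner.
(* The quantities depending on the length [n] of the inner sum are frozen as [c], [d], [e], which
   makes induction on the outer length possible. *)
have outer (c d e : int) (m : nat) :
    2 * \sum_(i < m) (6 * c * i%:R ^+ 2 - 6 * i%:R * c * d + e) =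
    2 * c * m%:R * (m%:R - 1) * (2 * m%:R - 1) - 6 * c * d * m%:R * (m%:R - 1)
    + 2 * m%:R * e.
  elim: m => [|m IHm]; first by rewrite big_ord0; ring.
  by rewrite big_ord_recr /= mulrDr IHm -[m.+1]addn1 natrD; ring.
by apply: (@mulfI _ 2) => //; rewrite outer; ring.
Qed.

(** After sorting, the entries at positions [i] and [j] differ by at least the distance of the
    positions, so consecutive integers are the extreme case. *)
Lemma sum_sqr_diff_inj (n : nat) (y : nat -> int) :
  {in gtn n &, injective y} ->
  n%:R ^+ 2 * (n%:R ^+ 2 - 1)
  <= 6 * \sum_(i < n) \sum_(j < n) (y i - y j) ^+ 2 :> int.
Proof.
move=> y_inj; rewrite -sum_sqr_diff_ord ler_pM2l //.
pose s := sort <=%R [seq y i | i <- iota 0 n].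
have s_size : size s = n by rewrite size_sort size_map size_iota.
have s_perm : perm_eq s [seq y i | i <- iota 0 n] by rewrite perm_sort.
have s_lt : sorted <%R s.
  rewrite lt_sorted_uniq_le sort_le_sorted andbT (perm_uniq s_perm).
  rewrite map_inj_in_uniq ?iota_uniq //.
  by move=> i j; rewrite !mem_iota /= !add0n => ii jj; apply: y_inj.
have s_gap (j d : nat) : (j + d < n)%N -> d%:R <= s`_(j + d) - s`_j.
  elim: d => [|d IHd] lt_n; first by rewrite addn0 subrr.
  rewrite addnS in lt_n *.
  have lt_s : s`_(j + d) < s`_(j + d).+1.
    by rewrite (lt_sorted_ltn_nth 0 s_lt) ?inE ?s_size ?(ltnW lt_n).
  by have := IHd (ltnW lt_n); move: lt_s; lia.
have -> : \sum_(i < n) \sum_(j < n) (y i - y j) ^+ 2 =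
    \sum_(i < n) \sum_(j < n) (s`_i - s`_j) ^+ 2.
  have sumE (F : int -> int) : \sum_(j < n) F (y j) = \sum_(j < n) F s`_j.
    rewrite -(big_mkord xpredT (fun j => F (y j))) -(big_mkord xpredT (fun j => F s`_j)).
    rewrite -[in RHS]s_size -(big_nth 0 xpredT) (perm_big _ s_perm) /= big_map.
    by rewrite /index_iota subn0.
  under eq_bigr => i _ do rewrite (sumE (fun a => (y i - a) ^+ 2)).
  exact: (sumE (fun a => \sum_(j < n) (a - s`_j) ^+ 2)).
apply: ler_sum => i _; apply: ler_sum => j _.
wlog le_ij : i j / (i <= j)%N.
  move=> W; case: (leqP i j) => [/W //|/ltnW/W].
  by rewrite -sqrrN opprB -(sqrrN (_ - s`_i)) opprB -sqrrN opprB.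
have := @s_gap i (j - i)%N; rewrite subnKC // ltn_ord natrB // => /(_ isT) gap.
rewrite -sqrrN -(sqrrN (s`_i - _)) !opprB ler_sqr ?nnegrE //.
- by rewrite subr_ge0 ler_nat.
- by apply: le_trans gap; rewrite subr_ge0 ler_nat.
Qed.

(** The rows [i0] and [i1] together contribute at least [r * b], and each of the other [r - 2] rows
    at least [b] through its columns [i0] and [i1]. *)
Lemma sum_pair_ge (R : numDomainType) (r : nat) (t : 'I_r -> 'I_r -> R) (b : R)
    (i0 i1 : 'I_r) :
  i0 != i1 -> (forall i j, 0 <= t i j) -> (forall i j, t i j = t j i) ->
  (forall i, b <= t i i0 + t i i1) ->
  2 * (r%:R - 1) * b <= \sum_(i < r) \sum_(j < r) t i j.
Proof.
move=> ni t0 tC tb.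
have ni' : i1 != i0 by rewrite eq_sym.
have -> : 2 * (r%:R - 1) * b = r%:R * b + (r%:R * b - 2 * b) by ring.
rewrite (bigD1 i0) //= [X in _ <= _ + X](bigD1 i1) //= [X in _ <= X]addrA; apply: lerD.
  rewrite -big_split /= mulr_natl -[X in _ *+ X]card_ord -sumr_const.
  by apply: ler_sum => i _; rewrite tC (tC i1); apply: tb.
have <- : \sum_(i < r | (i != i0) && (i != i1)) b = r%:R * b - 2 * b.
  have := sumr_const 'I_r b; rewrite (bigD1 i0) //= (bigD1 i1) //= card_ord.
  rewrite -[_ *+ r]mulr_natl => <-.
  ring.
apply: ler_sum => i _; apply: le_trans (tb i) _.
rewrite (bigD1 i0) //= (bigD1 i1) //= [X in _ <= X]addrA lerDl.
exact: sumr_ge0.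
Qed.

(** * Integer polynomials at roots of unity *)

(** Elements of [Z[x]] are handled through polynomials representing them: a conjugate is then the
    same polynomial evaluated at another root. *)
Definition evZ (x : algC) : {poly int} -> algC := horner_eval x \o map_poly intr.

HB.instance Definition _ (x : algC) :=
  GRing.RMorphism.copy (evZ x) (horner_eval x \o map_poly intr).

Lemma evZX x : evZ x 'X = x.
Proof. by rewrite /evZ /= /horner_eval map_polyX hornerX. Qed.

Lemma evZXn x n : evZ x 'X^n = x ^+ n.
Proof. by rewrite rmorphXn /= evZX. Qed.

Lemma evZC x c : evZ x c%:P = c%:~R.
Proof. by rewrite /evZ /= /horner_eval map_polyC hornerC. Qed.

Lemma evZ_comp x f g : evZ x (f \Po g) = evZ (evZ x g) f.
Proof. by rewrite /evZ /= /horner_eval map_comp_poly horner_comp. Qed.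

Lemma evZ1 f : evZ 1 f = f.[1]%:~R.
Proof. by rewrite /evZ /= /horner_eval -(horner_map intr) rmorph1. Qed.

Lemma evZ_aut (s : {rmorphism algC -> algC}) x f : s (evZ x f) = evZ (s x) f.
Proof.
rewrite /evZ /= /horner_eval -horner_map -map_poly_comp; congr _.[_].
by apply: eq_map_poly => c /=; rewrite rmorph_int.
Qed.

Lemma Aint_evZ x f : x \in Aint -> evZ x f \in Aint.
Proof.
move=> xA; elim/poly_ind: f => [|f c IHf]; first by rewrite rmorph0.
by rewrite rmorphD rmorphM /= evZX evZC rpredD ?Aint_int // rpredM.
Qed.

Lemma evZ_split (r : nat) (f : {poly int}) : (0 < r)%N ->
  exists g : nat -> {poly int},
    forall x, evZ x f = \sum_(i < r) x ^+ i * evZ (x ^+ r) (g i).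
Proof.
move=> /(poly_split f)[g Dg]; exists g => x; rewrite {1}Dg rmorph_sum.
by apply: eq_bigr => i _; rewrite rmorphM /= evZ_comp !evZXn.
Qed.

(** * Division by [1 - x] *)

Section Quotient.

Variables (p Q : nat) (b : nat -> int).
Hypotheses (p_gt0 : (0 < p)%N) (Q_gt0 : (0 < Q)%N).

Let c : int := \sum_(n < p * Q) b n.

(* Partial sums of [p * b n - c * [Q %| n]]: subtracting [c] at the multiples of
   [Q] makes the total vanish, and it does not change the value at a root of
   unity [x] of order dividing [p * Q] with [x ^+ Q != 1]. *)
Definition quot_coef (n : nat) : int :=
  p%:R * (\sum_(l < n.+1) b l) - c * (n %/ Q).+1%:R.

Definition quot (x : algC) : algC :=
  \sum_(n < p * Q) (quot_coef n)%:~R * x ^+ n.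

Lemma quotE (x : algC) : x ^+ (p * Q) = 1 -> x ^+ Q != 1 ->
  (1 - x) * quot x = p%:R * \sum_(n < p * Q) (b n)%:~R * x ^+ n.
Proof.
move=> x1 xQ.
(* Summation by parts; for [L = p * Q - 1] the boundary term vanishes because the last coefficient
   is zero. *)
have partial L : (1 - x) * \sum_(n < L.+1) (quot_coef n)%:~R * x ^+ n =
    \sum_(n < L.+1) (p%:R * (b n)%:~R - c%:~R * (Q %| n)%:R) * x ^+ n
    - (quot_coef L)%:~R * x ^+ L.+1.
  elim: L => [|L IHL].
    rewrite !big_ord1 /quot_coef big_ord1 div0n dvdn0 !expr0 expr1.
    by rewrite !(rmorphB, rmorphM) /=; ring.
  rewrite big_ord_recr mulrDr IHL [in RHS]big_ord_recr /=.
  have -> : (quot_coef L.+1)%:~R = (quot_coef L)%:~R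
      + (p%:R * (b L.+1)%:~R - c%:~R * (Q %| L.+1)%:R) :> algC.
    rewrite /quot_coef big_ord_recr /= divnS // -addnS natrD.
    by rewrite !(rmorphB, rmorphM, rmorphD) /= !rmorph_nat; ring.
  by rewrite !exprS; ring.
have pQ_gt0 : (0 < p * Q)%N by rewrite muln_gt0 p_gt0.
have := partial (p * Q).-1; rewrite prednK // -/(quot x) => ->.
have -> : quot_coef (p * Q).-1 = 0.
  rewrite /quot_coef prednK // -/c.
  have -> : ((p * Q).-1 %/ Q).+1 = p.
    case: (p) p_gt0 => // p' _; rewrite mulSn addnC -(prednK Q_gt0) addnS /= prednK //.
    by rewrite divnMDl // divn_small ?prednK // addn0.
  by rewrite mulrC subrr.
rewrite mul0r subr0.
under eq_bigr => n _ do rewrite mulrBl -!mulrA.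
rewrite sumrB -!mulr_sumr.
(* The multiples of [Q] give a full geometric sum of [x ^+ Q], a [p]-th root of unity other than
   1. *)
suff -> : \sum_(n < p * Q) (Q %| n)%:R * x ^+ n = 0 by rewrite mulr0 subr0.
rewrite mulnC (sum_ord_mul Q p (fun n => (Q %| n)%:R * x ^+ n)).
rewrite (bigD1 (Ordinal Q_gt0)) //= [X in _ + X]big1 => [|j nj].
  rewrite addr0 -[RHS](sum_root_unity (r := p) (x := x ^+ Q))
    -?exprM ?[(Q * p)%N]mulnC //.
  by apply: eq_bigr => l _; rewrite add0n dvdn_mulr // mul1r -exprM.
rewrite big1 // => l _; rewrite dvdn_addl ?dvdn_mulr // gtnNdvd ?mul0r //.
by rewrite lt0n; apply: contra nj => /eqP j0; apply/eqP/val_inj.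
Qed.

(** Modulo [p] the coefficients at [i + Q * l] with [l < p] are [- c * (l + 1)], hence pairwise
    distinct when the prime [p] does not divide [c]. *)
Lemma quot_coef_shift (i l : nat) : (i < Q)%N ->
  exists m : int, quot_coef (i + Q * l) = p%:R * m - c * l.+1%:R.
Proof.
move=> iQ; exists (\sum_(j < (i + Q * l).+1) b j).
by rewrite /quot_coef addnC mulnC divnMDl // divn_small // addn0.
Qed.

End Quotient.

(** * The lower bound away from [1 - xi] *)

Section PrimePower.

Variables (p k : nat).
Hypothesis p_pr : prime p.
Let Q : nat := (p ^ k)%N.
Let p_gt0 : (0 < p)%N := prime_gt0 p_pr.
Let Q_gt0 : (0 < Q)%N. Proof. by rewrite expn_gt0 p_gt0. Qed.
Let pC_neq0 : p%:R != 0 :> algC. Proof. by rewrite pnatr_eq0 -lt0n. Qed.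

Lemma coprime_pQ (m : nat) : coprime m (p * Q) = coprime m p.
Proof. by rewrite -expnS coprime_pexpr. Qed.

(** Exponents are reduced modulo [p * Q]; the sum of the coefficients is unchanged, being the value
    at 1. *)
Lemma evZ_residues (f : {poly int}) : exists b : nat -> int,
  \sum_(n < p * Q) b n = f.[1] /\
  (forall x : algC, x ^+ (p * Q) = 1 ->
     evZ x f = \sum_(n < p * Q) (b n)%:~R * x ^+ n).
Proof.
have pQ_gt0 : (0 < p * Q)%N by rewrite muln_gt0 p_gt0.
have [g Dg] := evZ_split f pQ_gt0; exists (fun n => (g n).[1]); split.
  apply: (@intr_inj algC); rewrite -evZ1 Dg rmorph_sum /=.
  by apply: eq_bigr => i _; rewrite !expr1n mul1r evZ1.
by move=> x x1; rewrite Dg x1; apply: eq_bigr => i _; rewrite evZ1 mulrC.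
Qed.

Lemma prim_root_sub1 (N j : nat) (z : algC) : (N * (p * Q)).-primitive_root z ->
  coprime j (p * Q) -> ((z ^+ j) ^+ N) ^+ Q != 1.
Proof.
move=> z_prim; rewrite coprime_pQ coprime_sym prime_coprime // => p_j.
have := prim_order_gt0 z_prim; rewrite !muln_gt0 => /and3P[N_gt0 _ _].
rewrite -!exprM -(prim_order_dvd z_prim).
by rewrite mulnCA dvdn_pmul2r // muln_gt0 N_gt0.
Qed.

(** The division formula for the constant polynomial 1 exhibits [p / (1 - x)] as an integer
    polynomial in [x]. *)
Lemma Aint_div_sub1 (N : nat) (z : algC) : (N * (p * Q)).-primitive_root z ->
  exists2 h : {poly int}, p%:R = (1 - z ^+ N) * evZ (z ^+ N) h
     & p%:R / (1 - z ^+ N) \in Aint.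
Proof.
move=> z_prim; set x := z ^+ N.
have x1 : x ^+ (p * Q) = 1 by rewrite -exprM (prim_expr_order z_prim).
have xQ : x ^+ Q != 1.
  have := prim_root_sub1 (j := 1) z_prim; rewrite expr1; apply.
  by rewrite /coprime gcd1n.
pose b (n : nat) : int := (n == 0)%:R.
have := quotE b p_gt0 Q_gt0 x1 xQ.
have pQ_gt0 : (0 < p * Q)%N by rewrite muln_gt0 p_gt0.
rewrite [X in _ = _ * X](bigD1 (Ordinal pQ_gt0)) //= big1 => [|n nz]; last first.
  by rewrite /b; case: eqP => [n0|]; [case/eqP: nz; apply: val_inj | rewrite mul0r].
rewrite expr0 mulr1 addr0 mulr1.
pose h : {poly int} := \sum_(n < p * Q) (quot_coef p Q b n)%:P * 'X^n.
have Dh : quot p Q b x = evZ x h.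
  by rewrite rmorph_sum; apply: eq_bigr => n _; rewrite rmorphM /= evZC evZXn.
rewrite Dh => Dp; exists h => //.
have x_neq1 : 1 - x != 0.
  by rewrite subr_eq0 eq_sym; apply: contra xQ => /eqP->; rewrite expr1n.
rewrite -Dp mulrAC divff // mul1r Aint_evZ // rpredX //.
exact: Aint_prim_root z_prim.
Qed.

(** Modulo [Q] the coefficients of the quotient split into [Q] families of [p] distinct integers.
    The bound is [Q * Q * (p ^ 2 * (p ^ 2 - 1) / 12) / p ^ 2], where
    [totient (p * Q) = Q * (p - 1)]. *)
Lemma psum_prime_power (z : algC) (f : {poly int}) :
  (p * Q).-primitive_root z -> ~~ (evZ z f / (1 - z) \in Aint) ->
  (Q * p.+1)%:R / 12 * (totient (p * Q))%:R <=
    psum (p * Q) z (fun w => `|evZ w f| ^+ 2 / `|1 - w| ^+ 2).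
Proof.
move=> z_prim fz.
have zA := Aint_prim_root z_prim.
(* Modulo [1 - z] the value of [f] is [f.[1]], and [1 - z] divides [p]; so [p] dividing [f.[1]]
   would contradict [fz]. *)
have p_f1 : ~~ (p%:Z %| f.[1])%Z.
  apply: contra fz => /dvdzP[m Dm].
  have /factor_theorem[h Dh] : root (f - (f.[1])%:P) 1.
    by rewrite /root !hornerE subrr.
  have -> : f = h * ('X - 1%:P) + (m * p%:Z)%:P by rewrite -Dh -Dm subrK.
  have z1 : 1 - z != 0.
    have := @prim_root_sub1 1 1 z; rewrite mul1n /coprime gcd1n => /(_ z_prim isT).
    by rewrite subr_eq0 [1 == z]eq_sym; apply: contra => /eqP->; rewrite !expr1n.
  rewrite rmorphD rmorphM rmorphB /= evZX !evZC rmorph1 mulrDl rpredD //.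
    by rewrite -mulrA -opprB mulNr divff // mulrN1 rpredN Aint_evZ.
  rewrite rmorphM /= -mulrA rpredM ?Aint_int //.
  have := @Aint_div_sub1 1 z; rewrite mul1n expr1 => /(_ z_prim)[h' _].
  by rewrite -pmulrn.
have [b [b1 Db]] := evZ_residues f.
set y := quot_coef p Q b.
pose G (i : nat) (w : algC) := \sum_(l < p) (y (i + Q * l)%N)%:~R * w ^+ l.
have -> : psum (p * Q) z (fun w => `|evZ w f| ^+ 2 / `|1 - w| ^+ 2) =
    (p%:R ^+ 2)^-1 * psum (p * Q) z (fun w => `|quot p Q b w| ^+ 2 * 1).
  rewrite [RHS]mulr_sumr; apply: eq_bigr => j co_j.
  set w := z ^+ j; have w1 : w ^+ (p * Q) = 1.
    by rewrite exprAC (prim_expr_order z_prim) expr1n.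
  have wQ : w ^+ Q != 1.
    by have := @prim_root_sub1 1 j z; rewrite mul1n expr1 => /(_ z_prim co_j).
  have w_neq1 : `|1 - w| != 0.
    by rewrite normr_eq0 subr_eq0 eq_sym; apply: contra wQ => /eqP->; rewrite expr1n.
  apply: (canLR (mulfK _)); first by rewrite expf_neq0.
  rewrite mulr1 -mulrA -exprMn -normrM [quot _ _ _ _ * _]mulrC.
  rewrite (quotE b p_gt0 Q_gt0 w1 wQ) -Db // normrM normr_nat exprMn mulKf //.
  by rewrite expf_neq0.
have FG (x : algC) : quot p Q b x = \sum_(i < Q) x ^+ i * G i (x ^+ Q).
  rewrite /quot -/y mulnC (sum_ord_mul Q p (fun n => (y n)%:~R * x ^+ n)).
  apply: eq_bigr => i _; rewrite mulr_sumr; apply: eq_bigr => l _.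
  by rewrite exprD exprM; ring.
have -> : psum (p * Q) z (fun w => `|quot p Q b w| ^+ 2 * 1)
   = Q%:R * \sum_(i < Q) psum p (z ^+ Q) (fun w => `|G i w| ^+ 2 * 1).
  apply: (psum_ramified (fun=> 1) z_prim FG) => m co_m.
  by move: (coprime_pQ m); rewrite coprimeMr co_m /= => ->.
have w_prim := zN_prim (N := Q) (r := p) (z := z).
rewrite mulnC in w_prim; have {}w_prim := w_prim z_prim.
(* All [p]-th roots of unity except 1 are primitive, so Parseval minus the term at 1 leaves half the
   sum of squared differences. *)
have inner (i : 'I_Q) : p%:R ^+ 2 * (p%:R ^+ 2 - 1) / 12 <=
    psum p (z ^+ Q) (fun w => `|G i w| ^+ 2 * 1).
  have -> : psum p (z ^+ Q) (fun w => `|G i w| ^+ 2 * 1) =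
      2^-1 * \sum_(l < p) \sum_(l' < p)
         `|(y (i + Q * l)%N)%:~R - (y (i + Q * l')%N)%:~R : algC| ^+ 2.
    rewrite -(sum_sqr_diff p (fun l => (y (i + Q * l)%N)%:~R)).
    have := parseval (fun l => (y (i + Q * l)%N)%:~R) w_prim.
    rewrite (bigD1 (Ordinal p_gt0)) //= => <-.
    have -> : `|\sum_(i0 < p) (y (i + Q * i0)%N)%:~R : algC| ^+ 2 =
        `|\sum_(i0 < p) (y (i + Q * i0)%N)%:~R * (z ^+ Q) ^+ (i0 * 0)| ^+ 2.
      by congr (`|_| ^+ 2); apply: eq_bigr => l _; rewrite muln0 expr0 mulr1.
    rewrite addrAC subrr add0r; apply: eq_big => [l|l _].
      rewrite coprime_sym prime_coprime //; case: l => -[|l] lp; first by rewrite dvdn0.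
      by rewrite gtnNdvd.
    rewrite mulr1; congr (`|_| ^+ 2); apply: eq_bigr => l' _.
    by rewrite [(l' * l)%N]mulnC [(z ^+ Q) ^+ (l * l')]exprM.
  have y_inj : {in gtn p &, injective (fun l => y (i + Q * l)%N)}.
    move=> l l' /=; rewrite !inE /y => lp l'p.
    have [m ->] := quot_coef_shift p b Q_gt0 l (ltn_ord i).
    have [m' ->] := quot_coef_shift p b Q_gt0 l' (ltn_ord i).
    rewrite b1 => e.
    have /Gauss_dvdzr : coprimez p%:Z f.[1].
      by rewrite coprimezE prime_coprime.
    move=> /(_ (l%:Z - l'%:Z)) dv.
    have : (p%:Z %| f.[1] * (l%:Z - l'%:Z))%Z.
      by apply/dvdzP; exists (m - m'); move: e; lia.
    rewrite dv => /dvdzP[d Dd].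
    have : `|(l%:Z - l'%:Z)%R| < p%:Z by move: lp l'p; lia.
    have [d0|d0] := eqVneq d 0; first by move: Dd; rewrite d0; lia.
    by rewrite Dd normrM; nia.
  have := sum_sqr_diff_inj y_inj; rewrite -(ler_int algC) => le_y.
  rewrite ler_pdivrMr // [leRHS]mulrC [leRHS]mulrA.
  have -> : 12 * 2^-1 = 6 :> algC by apply: (canLR (mulfK _)); rewrite -?natrM ?pnatr_eq0.
  move: le_y; rewrite !(rmorphM, rmorphB, rmorphXn) /= rmorph_sum /= !rmorph_nat rmorph1.
  congr (_ <= _).
  congr (_ * _).
  apply: eq_bigr => l _; rewrite rmorph_sum; apply: eq_bigr => l' _.
  rewrite -rmorphB rmorphXn /= real_normK //. exact: Rreal_int.
rewrite -(ler_pM2l (x := p%:R ^+ 2)) ?exprn_gt0 ?ltr0n //.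
rewrite [leRHS]mulrA divff ?expf_neq0 // mul1r.
have := @ler_sum _ _ (index_enum 'I_Q) xpredT _ _ (fun i _ => inner i).
rewrite sumr_const card_ord -[_ *+ Q]mulr_natl => /(ler_wpM2l (ler0n algC Q)).
apply: le_trans; rewrite le_eqVlt; apply/orP; left; apply/eqP.
rewrite -expnS totient_pfactor // /= -/Q !natrM -[p.+1]addn1 natrD.
have -> : p.-1%:R = p%:R - 1 :> algC by rewrite -subn1 natrB.
by ring.
Qed.

End PrimePower.

(** Ramified descent for the constant function 1, whose only nonzero component is [G 0]. *)
Lemma totient_ramified (N r : nat) : (0 < N)%N -> (0 < r)%N ->
  (forall m : nat, coprime m N -> coprime m r) ->
  totient (N * r) = (r * totient N)%N.
Proof.
move=> N_gt0 r_gt0 co.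
have Nr_gt0 : (0 < N * r)%N by rewrite muln_gt0 N_gt0.
have [z z_prim] := C_prim_root_exists Nr_gt0.
pose G (i : nat) (x : algC) : algC := (i == 0)%:R.
have FG (x : algC) : 1 = \sum_(i < r) x ^+ i * G i (x ^+ r).
  rewrite (bigD1 (Ordinal r_gt0)) //= /G big1 ?addr0 ?mulr1 // => i i0.
  rewrite (_ : (i == 0 :> nat) = false) ?mulr0 //.
  by apply: contraNF i0 => /eqP i0; apply/eqP/val_inj.
apply/eqP; rewrite -(eqr_nat algC) natrM -(psum1 _ z) -(psum1 N (z ^+ r)).
have := @psum_ramified N r z (fun=> 1) (fun=> 1) G z_prim FG co.
rewrite normr1 expr1n mulr1 => ->; apply/eqP; congr (_ * _).
rewrite (bigD1 (Ordinal r_gt0)) //= big1 => [|i i0].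
  by rewrite addr0; apply: eq_psum => j _; rewrite /G normr1 expr1n mulr1.
apply: big1 => j _; rewrite /G (_ : (i == 0 :> nat) = false) ?normr0 ?expr0n ?mul0r //.
by apply: contraNF i0 => /eqP i0; apply/eqP/val_inj.
Qed.

(** Strong induction on [M], whose smallest prime factor [r] is removed at each step; [M = 1] is the
    prime power case. *)
Lemma psum_ge (p k M : nat) (z : algC) (f : {poly int}) :
  prime p -> (M * (p * p ^ k)).-primitive_root z ->
  ~~ (evZ z f / (1 - z ^+ M) \in Aint) ->
  (p ^ k * p.+1)%:R / 12 * (totient (M * (p * p ^ k)))%:R <=
    psum (M * (p * p ^ k)) z (fun w => `|evZ w f| ^+ 2 / `|1 - w ^+ M| ^+ 2).
Proof.
move=> p_pr; set kap := _ / 12; set q := (p * p ^ k)%N.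
have kap0 : 0 <= kap by rewrite divr_ge0 ?ler0n.
elim/ltn_ind: M z f => M IHM z f z_prim fz.
have [M_gt0 q_gt0] : (0 < M)%N /\ (0 < q)%N.
  by have := prim_order_gt0 z_prim; rewrite muln_gt0 => /andP[].
have [M1|M_neq1] := eqVneq M 1%N.
  move: z_prim fz; rewrite {}M1 mul1n expr1 => z_prim fz.
  apply: le_trans (psum_prime_power p_pr z_prim fz) _.
  by rewrite /psum; under [leRHS]eq_bigr => j _ do rewrite expr1.
have M_gt1 : (1 < M)%N by case: (M) M_gt0 M_neq1 => [|[]].
set r := pdiv M; have r_pr : prime r := pdiv_prime M_gt1.
have r_gt0 := prime_gt0 r_pr.
pose M' := (M %/ r)%N.
have DM : M = (M' * r)%N by rewrite divnK // pdiv_dvd.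
have lt_M' : (M' < M)%N by rewrite ltn_Pdiv // prime_gt1.
move: z_prim fz; rewrite {2 5}DM (_ : M * q = M' * q * r)%N; last by rewrite {1}DM mulnAC.
clearbody M'; set N := (M' * q)%N => z_prim fz.
have x_prim := zr_prim z_prim; set x := z ^+ r in x_prim.
have N_gt0 := prim_order_gt0 x_prim.
have xA := Aint_prim_root x_prim; have zA := Aint_prim_root z_prim.
have [g Dg] := evZ_split f r_gt0.
rewrite mulnC exprM -/x in fz.
pose W (w : algC) := (`|1 - w ^+ M'| ^+ 2)^-1.
have -> : psum (N * r) z (fun w => `|evZ w f| ^+ 2 / `|1 - w ^+ (M' * r)| ^+ 2)
    = psum (N * r) z (fun w => `|evZ w f| ^+ 2 * W (w ^+ r)).
  by apply: eq_bigr => j _; rewrite /W -[(_ ^+ r) ^+ M']exprM [(r * M')%N]mulnC.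
have t0 h : 0 <= psum N x (fun w => `|evZ w h| ^+ 2 * W w).
  by apply: psum_ge0 => j; rewrite mulr_ge0 ?invr_ge0 ?exprn_ge0.
have IH h := IHM M' lt_M' x h x_prim.
have [r_N|r_N] := boolP (r %| N)%N.
  have co (m : nat) : coprime m N -> coprime m r by apply: coprime_dvdr.
  rewrite (@psum_ramified N r z W (evZ^~ f) (fun i w => evZ w (g i)) z_prim Dg co).
  rewrite totient_ramified // natrM mulrCA.
  apply: ler_wpM2l => //.
  (* Some component is not a multiple of [1 - x ^+ M'], and one suffices: totient and descent gain
     the same factor [r]. *)
  have /existsP[i ni] : [exists i : 'I_r, ~~ (evZ x (g i) / (1 - x ^+ M') \in Aint)].
    rewrite -negb_forall; apply: contra fz => /forallP gA.
    rewrite Dg mulr_suml rpred_sum // => i _.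
    by rewrite -mulrA rpredM ?rpredX.
  apply: le_trans (IH _ ni) _; rewrite (bigD1 i) //= lerDl.
  by apply: sumr_ge0.
have co_r : coprime N r by rewrite coprime_sym prime_coprime.
rewrite totient_coprime // (totient_prime r_pr) natrM.
pose rho := (r ^ (totient N).-1)%N.
have rhoE : r * rho = 1 %[mod N].
  by rewrite -expnS prednK ?totient_gt0 // Euler_exp_totient // coprime_sym.
rewrite (@psum_unramified N r z W (evZ^~ f) (fun i w => evZ w (g i)) z_prim Dg rho r_pr rhoE).
pose H i := 'X^(rho * i) * g i.
have HE i w : evZ w (H i) = w ^+ (rho * i) * evZ w (g i).
  by rewrite rmorphM /= evZXn.
have z0 : z != 0 by rewrite -normr_eq0 (normr_prim_root z_prim) oner_eq0.
have x0 : x != 0 by rewrite expf_neq0.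
(* [x ^+ rho] is the [r]-th root of [x] lying in the smaller field, so [th] is a nontrivial [r]-th
   root of unity, and [f] takes at [z] the value [\sum_i th ^+ i * H i]. *)
pose th := z / x ^+ rho.
have th_r : th ^+ r = 1.
  rewrite expr_div_n -/x -exprM mulnC -(expr_mod _ (prim_expr_order x_prim)) rhoE.
  by rewrite (expr_mod _ (prim_expr_order x_prim)) expr1 divff.
have th_A : th \in Aint by apply: (Aint_unity_root r_gt0); apply/unity_rootP.
have th_neq1 : th != 1.
  apply/eqP => th1; have Dz : z = x ^+ rho.
    by rewrite -[LHS](divfK (expf_neq0 rho x0)) -/th th1 mul1r.
  have : z ^+ N = 1 by rewrite Dz exprAC (prim_expr_order x_prim) expr1n.
  move/eqP; rewrite -(prim_order_dvd z_prim) => /(dvdn_leq N_gt0).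
  by rewrite leqNgt ltn_Pmulr // prime_gt1.
have fE : evZ z f = \sum_(i < r) th ^+ i * evZ x (H i).
  rewrite Dg; apply: eq_bigr => i _; rewrite HE mulrA -/x; congr (_ * _).
  by rewrite exprM -exprMn divfK // expf_neq0.
pose bad i j := ~~ (evZ x (H i - H j) / (1 - x ^+ M') \in Aint).
pose i0 : 'I_r := Ordinal r_gt0.
(* The powers of [th] sum to zero, so [H i0] may be subtracted from every component. *)
have /existsP[i1 bad1] : [exists i : 'I_r, bad i i0].
  rewrite -negb_forall; apply: contra fz => /forallP gA.
  have -> : evZ z f = \sum_(i < r) th ^+ i * evZ x (H i - H i0).
    under eq_bigr => i _ do rewrite rmorphB mulrBr.
    by rewrite sumrB -mulr_suml sum_root_unity // mul0r subr0.
  rewrite mulr_suml rpred_sum // => i _.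
  by rewrite -mulrA rpredM ?rpredX.
pose t (i j : 'I_r) := psum N x (fun w => `|evZ w (H i - H j)| ^+ 2 * W w).
have -> : \sum_(i < r) \sum_(i' < r) psum N x
    (fun w => `|w ^+ (rho * i) * evZ w (g i) - w ^+ (rho * i') * evZ w (g i')| ^+ 2 * W w)
    = \sum_(i < r) \sum_(j < r) t i j.
  apply: eq_bigr => i _; apply: eq_bigr => j _; apply: eq_bigr => l _.
  by rewrite rmorphB /= !HE.
rewrite [leRHS]mulrC ler_pdivlMr ?ltr0n //.
apply: le_trans
  (sum_pair_ge (i0 := i1) (i1 := i0) (t := t) (b := kap * (totient N)%:R) _ _ _ _).
- rewrite le_eqVlt; apply/orP; left; apply/eqP.
  have -> : r.-1%:R = r%:R - 1 :> algC by rewrite -subn1 natrB.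
  by ring.
- by apply/eqP => e; move: bad1; rewrite /bad e subrr rmorph0 mul0r rpred0.
- by move=> i j; apply: t0.
- by move=> i j; apply: eq_bigr => l _; rewrite -opprB rmorphN normrN.
(* [H i] cannot be congruent to both [H i0] and [H i1] modulo [1 - x ^+ M'], so the induction
   hypothesis applies to one of the two differences. *)
move=> i.
have [b0|b0] := boolP (bad i i0).
  by apply: le_trans (IH _ b0) _; rewrite lerDr t0.
have b1 : bad i1 i.
  apply: contra bad1 => b1.
  have -> : H i1 - H i0 = (H i1 - H i) + (H i - H i0) by rewrite addrA subrK.
  rewrite rmorphD mulrDl rpredD //; exact: negbNE b0.
apply: le_trans (IH _ b1) _; rewrite -[leLHS]/(t i1 i).
rewrite [t i1 i](_ : _ = t i i1) ?lerDl ?t0 //.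
by apply: eq_bigr => l _; rewrite -opprB rmorphN normrN.
Qed.

(** * The ring of integers is [Z[zeta]] *)

Lemma exprD_prime (R : comNzRingType) (r : nat) (a b : R) : prime r ->
  exists g, (a + b) ^+ r = a ^+ r + b ^+ r + r%:R * g.
Proof.
move=> r_pr; have r_gt0 := prime_gt0 r_pr.
exists (\sum_(i < r.-1) a ^+ (r - i.+1) * b ^+ i.+1 *+ ('C(r, i.+1) %/ r)).
rewrite exprDn -[in LHS](prednK r_gt0) big_ord_recl big_ord_recr /= !prednK //.
have -> : bump 0 r.-1 = r by rewrite /bump add1n prednK.
rewrite bin0 subn0 subnn binn !expr0 mulr1 mul1r !mulr1n -addrA; congr (_ + _).
rewrite addrC; congr (_ + _).
rewrite mulr_sumr; apply: eq_bigr => i _; rewrite /bump /= add1n mulr_natl -mulrnA divnK //.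
by rewrite prime_dvd_bin //= -ltn_predRL.
Qed.

Lemma exprD_prime_power (R : comNzRingType) (r s : nat) (a b : R) : prime r ->
  exists g, (a + b) ^+ (r ^ s) = a ^+ (r ^ s) + b ^+ (r ^ s) + r%:R * g.
Proof.
move=> r_pr; elim: s => [|s [g Dg]]; first by exists 0; rewrite mulr0 addr0.
rewrite expnSr !exprM Dg.
have [h ->] := exprD_prime (a ^+ (r ^ s) + b ^+ (r ^ s)) (r%:R * g) r_pr.
have [h' ->] := exprD_prime (a ^+ (r ^ s)) (b ^+ (r ^ s)) r_pr.
exists (h' + (r%:R * g) ^+ r.-1 * g + h).
have -> : (r%:R * g) ^+ r = r%:R * ((r%:R * g) ^+ r.-1 * g).
  by rewrite mulrCA -exprSr prednK ?prime_gt0.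
by rewrite !mulrDr !addrA.
Qed.

(** The identity [(1 - 'X^M) + 'X^M = 1] is raised to the power [p * p ^ k] modulo [p]; at [z] the
    power of ['X^M] is 1 and cancels the right side. *)
Lemma sub1_expr_prime_power (p k M : nat) (z : algC) : prime p ->
  (M * (p * p ^ k)).-primitive_root z ->
  exists g, (1 - z ^+ M) ^+ (p * p ^ k) = p%:R * evZ z g.
Proof.
move=> p_pr z_prim.
have [g Dg] := exprD_prime_power k.+1 (1 - 'X^M) ('X^M : {poly int}) p_pr.
exists (- g); move/(congr1 (evZ z)): Dg.
rewrite subrK expr1n !(rmorphD, rmorphN, rmorphXn, rmorphM, rmorph1) /= evZX.
rewrite -[(z ^+ M) ^+ _]exprM expnS (prim_expr_order z_prim) rmorph_nat => Dg.
by apply: (addIr (1 + p%:R * evZ z g)); rewrite addrA -Dg; ring.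
Qed.

Section RingOfIntegers.

Variables (N : nat) (z : algC).
Hypothesis z_prim : N.-primitive_root z.
Let zN : z ^+ N = 1 := prim_expr_order z_prim.
Let N_gt0 : (0 < N)%N := prim_order_gt0 z_prim.

Definition in_Zz (x : algC) := exists f : {poly int}, x = evZ z f.

(** Here [p] is a polynomial whose value at [z] generates an ideal of [Z[z]]; the class of [f]
    modulo this ideal is fixed by the [R]-th power map. *)
Definition frob_fixed (R : nat) (p f : {poly int}) :=
  exists h, evZ z f ^+ R = evZ z f + evZ z p * evZ z h.

(** The ideal contains [r], so the [R]-th power map is additive modulo it and the fixed classes form
    a ring, which contains the generator [z]. *)
Lemma frob_fixed_all (r s : nat) (p : {poly int}) : prime r ->
  (exists h, r%:R = evZ z p * evZ z h) -> frob_fixed (r ^ s) p 'X ->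
  forall f, frob_fixed (r ^ s) p f.
Proof.
move=> r_pr [hr Dr] pX; set R := (r ^ s)%N.
have R_gt0 : (0 < R)%N by rewrite expn_gt0 prime_gt0.
have P0 : frob_fixed R p 0.
  by exists 0; rewrite rmorph0 mulr0 addr0 expr0n eqn0Ngt R_gt0.
have P1 : frob_fixed R p 1 by exists 0; rewrite rmorph0 rmorph1 mulr0 addr0 expr1n.
have PD f g : frob_fixed R p f -> frob_fixed R p g -> frob_fixed R p (f + g).
  move=> [h Dh] [h' Dh'].
  have [k /(congr1 (evZ z))] := exprD_prime_power s f g r_pr.
  rewrite !(rmorphD, rmorphXn, rmorphM) /= -/R Dh Dh' rmorph_nat => Dk.
  exists (h + h' + hr * k); rewrite rmorphD /= Dk Dr.
  by rewrite !(rmorphD, rmorphM) /=; ring.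
have PN f : frob_fixed R p f -> frob_fixed R p (- f).
  move=> [h Dh].
  (* Expanding the power of [f - f = 0] avoids a case distinction on the parity of [R]. *)
  have [k /(congr1 (evZ z))] := exprD_prime_power s f (- f) r_pr.
  rewrite subrr !(rmorphD, rmorphXn, rmorphM) /= -/R Dh rmorph_nat rmorph0 expr0n.
  rewrite eqn0Ngt R_gt0 /= rmorphN Dr => Dk.
  exists (- h - hr * k); apply/eqP; rewrite -subr_eq0 [X in _ == X]Dk; apply/eqP.
  by rewrite !(rmorphB, rmorphN, rmorphM) /=; ring.
have PC c : frob_fixed R p c%:P.
  have Pn (n : nat) : frob_fixed R p (n%:Z)%:P.
    by elim: n => [//|n IHn]; rewrite -addn1 PoszD polyCD; apply: PD.
  by case: c => n; rewrite ?NegzE ?polyCN; [|apply: (PN)].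
elim/poly_ind => [//|f c [h Dh]]; apply: (PD _ _ _ (PC c)).
case: pX => h' DX; rewrite -/R in DX.
rewrite /frob_fixed !rmorphM /= exprMn Dh DX.
exists (h * ('X + p * h') + f * h').
by rewrite !(rmorphM, rmorphD) /=; ring.
Qed.

Lemma in_Zz_peel (R : nat) (p : {poly int}) (x : algC) : (1 < R)%N ->
  (forall f, frob_fixed R p f) -> evZ z p != 0 ->
  x \in Aint -> in_Zz (evZ z p * x) -> in_Zz x.
Proof.
move=> R_gt1 Rfix p0 xA [f Df].
have [q Dq] := floorpP xA.
have q_mon : q \is monic.
  have [q' [Dq' q'_mon] _] := minCpolyP x.
  have := q'_mon; rewrite -(map_monic (ratr : rat -> algC)) -Dq' Dq.
  rewrite !monicE lead_coef_map_inj ?rmorph0 //; last exact: intr_inj.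
  by rewrite (eqr_int _ _ 1).
pose n := (size q).-1.
have size_q : size q = n.+1.
  by rewrite prednK // size_poly_gt0 monic_neq0.
have xn : x ^+ n = - \sum_(i < n) (q`_i)%:~R * x ^+ i.
  have : root (minCpoly x) x by apply: root_minCpoly.
  rewrite Dq /root horner_coef size_map_inj_poly ?rmorph0 //; last exact: intr_inj.
  rewrite size_q big_ord_recr /= coef_map /=.
  have -> : q`_n = 1 by move/monicP: q_mon.
  rewrite mul1r addrC addr_eq0 => /eqP->; congr (- _); apply: eq_bigr => i _.
  by rewrite coef_map.
(* In the monic equation of [x] multiplied by [evZ z p ^+ n], a factor [evZ z p] is left over in
   every term, as the exponents on the right are below [n]. *)
have wn : exists h, evZ z f ^+ n = evZ z p * evZ z h.
  exists (- \sum_(i < n) (q`_i)%:P * p ^+ (n - i.+1) * f ^+ i).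
  rewrite -Df exprMn xn rmorphN mulrN mulrN rmorph_sum !mulr_sumr /=; congr (- _).
  apply: eq_bigr => i _; rewrite !rmorphM !rmorphXn /= evZC -Df exprMn.
  have -> : evZ z p ^+ n = evZ z p ^+ (n - i.+1) * evZ z p * evZ z p ^+ i.
    by rewrite -exprSr -exprD addSnnS subnK.
  by ring.
have iter t : exists h, evZ z f ^+ (R ^ t) = evZ z f + evZ z p * evZ z h.
  elim: t => [|t [h Dh]]; first by exists 0; rewrite rmorph0 mulr0 addr0.
  have [h' Dh'] := Rfix (f ^+ (R ^ t)).
  exists (h + h'); rewrite expnSr exprM; move: Dh'; rewrite rmorphXn /= => ->.
  by rewrite Dh rmorphD /=; ring.
(* Since [R ^ n] exceeds [n], the [R ^ n]-th power of the value of [f] is a multiple of [evZ z p],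
   and it is also congruent to that value. *)
have [h Dh] := iter n; have [h' Dh'] := wn.
exists (h' * f ^+ (R ^ n - n) - h); apply: (mulfI p0).
rewrite Df rmorphB rmorphM /= rmorphXn /= mulrBr mulrA -Dh' -exprD.
by rewrite subnKC ?(ltnW (ltn_expl _ _)) // Dh addrK.
Qed.

Lemma in_Zz_prime (r : nat) (x : algC) : prime r -> x \in Aint ->
  in_Zz (r%:R * x) -> in_Zz x.
Proof.
move=> r_pr xA rx; have r_gt1 := prime_gt1 r_pr.
have R_gt1 (M : nat) : (0 < M)%N -> (1 < r ^ totient M)%N.
  by move=> M_gt0; rewrite -{1}(expn0 r) ltn_exp2l // totient_gt0.
have [r_N|r_N] := boolP (r %| N)%N; last first.
  have co_r : coprime r N by rewrite prime_coprime.
  have rE : evZ z (r%:R) = r%:R by rewrite rmorph_nat.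
  apply: (in_Zz_peel (p := r%:R) (R_gt1 N N_gt0)); rewrite ?rE ?pnatr_eq0 -?lt0n ?prime_gt0 //.
  apply: frob_fixed_all => //; first by exists 1; rewrite rE rmorph1 mulr1.
  exists 0; rewrite evZX rmorph0 mulr0 addr0 -(expr_mod _ zN).
  by rewrite Euler_exp_totient // (expr_mod _ zN) expr1.
have [M co_M DN] := pfactor_coprime r_pr N_gt0.
have e_gt0 : (0 < logn r N)%N by rewrite logn_gt0 mem_primes r_pr N_gt0.
rewrite -(prednK e_gt0) expnS in DN; set k := (logn r N).-1 in DN.
have M_gt0 : (0 < M)%N by move: N_gt0; rewrite DN muln_gt0 => /andP[].
have z_prim' := z_prim; rewrite DN in z_prim'.
set xi := z ^+ M.
pose pi : {poly int} := 1 - 'X^M.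
have piE : evZ z pi = 1 - xi by rewrite rmorphB rmorph1 /= evZXn.
have [h0 Dr _] := Aint_div_sub1 r_pr z_prim'.
have {h0}Dr : exists h, r%:R = evZ z pi * evZ z h.
  by exists (h0 \Po 'X^M); rewrite piE Dr evZ_comp evZXn.
have pi0 : evZ z pi != 0.
  case: Dr => h Dr; apply: contra_eq_neq Dr => ->.
  by rewrite mul0r pnatr_eq0 -lt0n prime_gt0.
have fix_all : forall f, frob_fixed (r ^ totient M) pi f.
  apply: frob_fixed_all => //.
  have /eqP := Euler_exp_totient co_M.
  rewrite eqn_mod_dvd ?expn_gt0 ?prime_gt0 // => /dvdnP[m Dm].
  have DR : (r ^ totient M = M * m + 1)%N.
    by rewrite [(M * m)%N]mulnC -Dm subnK // expn_gt0 prime_gt0.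
  (* With [R = M * m + 1] one has [z ^+ R = z * xi ^+ m], and [1 - xi] divides [1 - xi ^+ m]. *)
  exists (- 'X * \sum_(i < m) 'X^M ^+ i).
  rewrite evZX rmorphM rmorphN rmorph_sum /= evZX piE DR exprD expr1 exprM -/xi.
  under eq_bigr => i _ do rewrite rmorphXn /= evZXn -/xi.
  have := subrX1 xi m; set S := \sum_(i < m) _ => e.
  by rewrite -[xi ^+ m](subrK 1) e; ring.
have peel m y : y \in Aint -> in_Zz (evZ z pi ^+ m * y) -> in_Zz y.
  elim: m y => [|m IHm] y yA; first by rewrite mul1r.
  rewrite exprSr -mulrA => /IHm.
  have piA : evZ z pi \in Aint by apply: Aint_evZ; apply: Aint_prim_root z_prim.
  move=> IH; apply: (in_Zz_peel (R_gt1 M M_gt0) fix_all pi0 yA).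
  by apply: IH; rewrite rpredM.
(* A power of [1 - xi] is a multiple of [r], so its product with [x] lies in [Z[z]]; the factors are
   then removed one at a time. *)
have [g Dg] := sub1_expr_prime_power r_pr z_prim'.
apply: (peel (r * r ^ k)%N) => //; case: rx => f Df; exists (g * f).
by rewrite piE Dg rmorphM /= -Df mulrAC mulrC.
Qed.

Theorem Aint_in_Zz (D : nat) (x : algC) : (0 < D)%N -> x \in Aint ->
  in_Zz (D%:R * x) -> in_Zz x.
Proof.
elim/ltn_ind: D x => D IHD x D_gt0 xA.
have [->|D_neq1] := eqVneq D 1%N; first by rewrite mul1r.
have D_gt1 : (1 < D)%N by case: (D) D_gt0 D_neq1 => [|[]].
have r_pr := pdiv_prime D_gt1; set r := pdiv D in r_pr.
have DD : D = (r * (D %/ r))%N by rewrite mulnC divnK // pdiv_dvd.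
rewrite DD natrM -mulrA => /(in_Zz_prime r_pr) Dx.
apply: (IHD (D %/ r)%N) => //; first by rewrite ltn_Pdiv // prime_gt1.
  by rewrite divn_gt0 ?prime_gt0 // dvdn_leq // pdiv_dvd.
by apply: Dx; rewrite rpredM // Aint_Cnat // rpred_nat.
Qed.

End RingOfIntegers.

(** Otherwise [p^-1], an element of [Z[z]] times a power of [(1 - z ^+ M)^-1], would be a nonzero
    rational algebraic integer of absolute value below 1. *)
Lemma inv_sub1_not_Aint (p k M : nat) (z : algC) : prime p ->
  (M * (p * p ^ k)).-primitive_root z -> ~~ ((1 - z ^+ M)^-1 \in Aint).
Proof.
move=> p_pr z_prim; apply/negP => invA.
have [g Dg] := sub1_expr_prime_power p_pr z_prim.
have p0 : p%:R != 0 :> algC by rewrite pnatr_eq0 -lt0n prime_gt0.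
have nz : 1 - z ^+ M != 0.
  have [h Dp _] := Aint_div_sub1 p_pr z_prim.
  by apply: contra_eq_neq Dp => ->; rewrite mul0r.
have /Cint_rat_Aint : (p%:R : algC)^-1 \in Crat by rewrite rpredV rpred_nat.
have Dp : evZ z g * (1 - z ^+ M)^-1 ^+ (p * p ^ k) = p%:R^-1.
  have := expf_neq0 (p * p ^ k) nz; rewrite exprVn Dg mulf_eq0 negb_or => /andP[_ g0].
  by rewrite invfM mulrCA divff ?mulr1.
have : (p%:R : algC)^-1 \in Aint.
  by rewrite -Dp rpredM ?rpredX ?Aint_evZ //; apply: Aint_prim_root z_prim.
move=> pA /(_ pA)/norm_intr_ge1; rewrite invr_neq0 // normfV normr_nat => /(_ isT).
by rewrite invr_ge1 ?unitfE ?ltr0n ?prime_gt0 // (ler_nat _ p 1) leqNgt prime_gt1.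
Qed.

(** * Traces and minima in cyclotomic fields *)

(** The matrix [V] of conjugates of a basis diagonalises multiplication by [b]. It is invertible
    because the Vandermonde matrix of the conjugates of [t] factors through it. *)
Lemma field_trace_embed (K : fieldExtType rat) (n : nat) (t : K)
    (sigma : 'I_n -> {rmorphism K -> algC}) :
  \dim {:K} = n -> injective (fun i => sigma i t) ->
  forall b : K, ratr (field_trace b) = \sum_i sigma i b.
Proof.
move=> Dn; case: n / Dn sigma => sigma t_inj b; set n := \dim {:K} in sigma t_inj *.
pose e := vbasis {:K}.
have exp_e (x : K) (j : 'I_n) :
    sigma j x = \sum_(i < n) ratr (coord e i x) * sigma j e`_i.
  rewrite {1}(coord_vbasis (memvf x)) rmorph_sum; apply: eq_bigr => i _.
  exact: rmorphZ_num.
pose V : 'M[algC]_n := \matrix_(i, j) sigma j e`_i.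
pose A : 'M[algC]_n := \matrix_(i, l) ratr (coord e l (b * e`_i)).
pose C : 'M[algC]_n := \matrix_(i, l) ratr (coord e l (t ^+ i)).
pose d : 'rV[algC]_n := \row_j sigma j b.
have V_unit : V \in unitmx.
  have : \det (Vandermonde n (\row_j sigma j t)) != 0.
    rewrite det_Vandermonde; apply/prodf_neq0 => i _; apply/prodf_neq0 => j lt_ij.
    rewrite !mxE subr_eq0; apply: contraTneq lt_ij => /t_inj->.
    by rewrite ltnn.
  have -> : Vandermonde n (\row_j sigma j t) = C *m V.
    apply/matrixP => i j; rewrite !mxE -rmorphXn exp_e.
    by apply: eq_bigr => l _; rewrite !mxE.
  by rewrite det_mulmx mulf_eq0 negb_or unitmxE unitfE => /andP[].
have AV : A *m V = V *m diag_mx d.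
  apply/matrixP => i j; rewrite mul_mx_diag !mxE mulrC -rmorphM exp_e.
  by apply: eq_bigr => l _; rewrite !mxE.
have -> : ratr (field_trace b) = \tr A.
  by rewrite /field_trace rmorph_sum; apply: eq_bigr => i _; rewrite mxE.
rewrite -[A](mulmxK V_unit) AV mxtrace_mulC mulmxA mulVmx // mul1mx mxtrace_diag.
by apply: eq_bigr => i _; rewrite mxE.
Qed.

(** Infinite descent on numerators. The double negation keeps the argument constructive and suffices
    for deriving a contradiction. *)
Lemma is_min_exists (S : rat -> Prop) (d : nat) : (0 < d)%N ->
  (forall r, S r -> exists n : nat, d%:R * r = n%:R) ->
  (exists r, S r) -> ~ ~ exists m, is_min S m.
Proof.
move=> d_gt0 S_nat [r0 Sr0] no_min.
have [n0 Dn0] := S_nat _ Sr0.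
elim/ltn_ind: n0 r0 Sr0 Dn0 => n IHn r Sr Dn.
apply: no_min; exists r; split=> // r' Sr'; rewrite leNgt; apply/negP => lt_r.
have [n' Dn'] := S_nat _ Sr'.
apply: (IHn n' _ r' Sr' Dn').
by rewrite -(ltr_nat rat) -Dn -Dn' ltr_pM2l // ltr0n.
Qed.

Section Cyclo.

Variable N : nat.
Hypothesis N_gt0 : (0 < N)%N.
Let z := zeta N.
Let z_prim : N.-primitive_root z := zeta_prim N_gt0.

Lemma cyclo_integer_Aint (x : cyclo N) : is_integer x -> cyclo_incl N x \in Aint.
Proof.
case=> q q_mon q_x; apply: (@root_monic_Aint (map_poly intr q)).
- have -> : map_poly intr q = map_poly (cyclo_incl N) (map_poly intr q).
    by rewrite -map_poly_comp; apply: eq_map_poly => c /=; rewrite rmorph_int.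
  by rewrite /root horner_map (rootP q_x) rmorph0.
- by apply: monic_map.
- by apply/polyOverP => i; rewrite coef_map /= rpred_int.
Qed.

Lemma cyclo_integerP (x : cyclo N) : is_integer x ->
  exists f : {poly int}, cyclo_incl N x = evZ z f.
Proof.
move=> /cyclo_integer_Aint xA.
have [zK DzK genz] := cyclo_gen N.
have /Fadjoin1_polyP[q Dx] : x \in <<1; zK>>%VS by rewrite genz memvf.
have [q' [a a0 Dq]] := rat_poly_scale q.
have Dax : a%:~R * cyclo_incl N x = evZ z q'.
  rewrite Dx -horner_map -map_poly_comp /= DzK.
  have -> : map_poly (cyclo_incl N \o in_alg (cyclo N)) q = map_poly ratr q.
    by apply: eq_map_poly => c; rewrite /= alg_num_field fmorph_rat.
  rewrite Dq map_polyZ /= hornerZ fmorphV /= ratr_int mulrA divff ?intr_eq0 // mul1r.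
  rewrite -map_poly_comp /evZ /= /horner_eval; congr _.[_].
  by apply: eq_map_poly => c; rewrite /= ratr_int.
apply: (Aint_in_Zz z_prim (D := `|a|%N)); rewrite ?absz_gt0 //.
(* The sign of [a] goes into the polynomial, the multiplier [D] being a natural number. *)
exists ((Num.sg a)%:P * q'); rewrite rmorphM /= evZC -Dax mulrA -rmorphM.
by rewrite pmulrn abszE -normrEsg.
Qed.

(** The minimal polynomial of the generator inside the field and the one of [z] in [algC], which is
    cyclotomic, divide each other. *)
Lemma dim_cyclo : \dim {:cyclo N} = totient N.
Proof.
have [zK DzK genz] := cyclo_gen N.
have [q Dq] := polyOver1P (minPolyOver 1%AS zK).
have [p [Dp p_mon] rootp] := minCpolyP z.
have size_p : size p = (totient N).+1.
  by rewrite -(size_map_poly (ratr : {rmorphism rat -> algC})) -Dp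
    (minCpoly_cyclotomic z_prim) size_cyclotomic.
have inclE f : map_poly (cyclo_incl N) (map_poly (in_alg (cyclo N)) f) = map_poly ratr f.
  by rewrite -map_poly_comp; apply: eq_map_poly => c; rewrite /= alg_num_field fmorph_rat.
have rootE f : root (map_poly (in_alg (cyclo N)) f) zK = (p %| f).
  by rewrite -rootp -/z -[z]DzK -inclE fmorph_root.
have dim_q : size q = (\dim {:cyclo N}).+1.
  rewrite -genz dim_Fadjoin dimv1 muln1 -size_minPoly Dq.
  by rewrite size_map_poly.
have p_q : p %| q by rewrite -rootE -Dq root_minPoly.
have q_p : minPoly 1 zK %| map_poly (in_alg (cyclo N)) p.
  by apply: minPoly_dvdp; [apply/polyOver1P; exists p | rewrite rootE].
apply/eqP; rewrite -eqSS -dim_q -size_p eqn_leq dvdp_leq ?monic_neq0 //= ?andbT; last first.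
  by move: q_p; rewrite Dq dvdp_map.
by apply: dvdp_leq => //; rewrite -size_poly_gt0 dim_q.
Qed.

(** Automorphisms of [algC] sending [z] to [z ^+ j] restrict to distinct embeddings, as many as the
    degree. *)
Lemma field_trace_psum (x : cyclo N) (F : algC -> algC) :
  (forall (u : {rmorphism algC -> algC}) (j : nat), coprime j N ->
     u z = z ^+ j -> u (cyclo_incl N x) = F (z ^+ j)) ->
  ratr (field_trace x) = psum N z F.
Proof.
move=> uF; have [zK DzK genz] := cyclo_gen N.
have /fin_all_exists[s Ds] (j : 'I_N) : exists u : {rmorphism algC -> algC},
    coprime j N -> u z = z ^+ j.
  (* The identity is a dummy value for indices not coprime to [N]. *)
  have [co_j|nco] := boolP (coprime j N); last by exists idfun.
  have [u Du] := Qn_aut_exists co_j.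
  by exists u => _; apply: Du; apply: prim_expr_order z_prim.
pose T := [pred j : 'I_N | coprime j N].
have cardT : #|T| = \dim {:cyclo N}.
  rewrite dim_cyclo totient_count_coprime big_mkord -sum1_card big_mkcond.
  by apply: eq_bigr => j _; rewrite inE coprime_sym; case: coprime.
pose sigma (i : 'I_#|T|) : {rmorphism cyclo N -> algC} :=
  s (enum_val i) \o cyclo_incl N.
have coT (i : 'I_#|T|) : coprime (enum_val i) N by have := enum_valP i.
rewrite (field_trace_embed (t := zK) (sigma := sigma)) //.
  rewrite /psum [RHS](eq_bigl (fun j => j \in T)) // (big_enum_val (A := T)).
  by apply: eq_bigr => i _; apply: uF; rewrite ?Ds.
move=> i i' /=; rewrite DzK !Ds //.
move/eqP; rewrite (eq_prim_root_expr z_prim) !modn_small // => /eqP/val_inj.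
exact: enum_val_inj.
Qed.

End Cyclo.

(** Conjugation inverts [zeta N], and every embedding sends the generator to a number of norm 1,
    whose conjugate is again its inverse. *)
Lemma cyclo_conj_embed (N : nat) (sigma : {rmorphism cyclo N -> algC}) (y : cyclo N) :
  (0 < N)%N -> sigma (cyclo_conj y) = (sigma y)^*.
Proof.
move=> N_gt0; have z_prim := zeta_prim N_gt0.
have [zK DzK genz] := cyclo_gen N.
have /Fadjoin1_polyP[q Dy] : y \in <<1; zK>>%VS by rewrite genz memvf.
have incl_alg (tau : {rmorphism cyclo N -> algC}) x :
    tau (map_poly (in_alg (cyclo N)) q).[x] = (map_poly ratr q).[tau x].
  rewrite -horner_map -map_poly_comp; congr _.[_].
  by apply: eq_map_poly => c; rewrite /= alg_num_field fmorph_rat.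
have conj_ratr x : ((map_poly (ratr : rat -> algC) q).[x])^* = (map_poly ratr q).[x^*].
  rewrite -horner_map -map_poly_comp; congr _.[_].
  by apply: eq_map_poly => c; rewrite /= fmorph_rat.
have zC := conj_norm1 (normr_prim_root z_prim).
have -> : cyclo_conj y = (map_poly (in_alg (cyclo N)) q).[zK^-1].
  apply: (fmorph_inj (cyclo_incl N)).
  by rewrite cyclo_conjE Dy !incl_alg conj_ratr fmorphV DzK zC.
rewrite Dy !incl_alg conj_ratr fmorphV conj_norm1 //.
apply: (@norm_root1 N) => //; rewrite -rmorphXn /=.
have -> : zK ^+ N = 1; last by rewrite rmorph1.
by apply: (fmorph_inj (cyclo_incl N)); rewrite rmorphXn /= DzK (prim_expr_order z_prim) rmorph1.
Qed.

(** The condition on [p] and [k] makes the constant of the lower bound exceed 1, so every unit has a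
    larger trace than [x]. *)
Lemma not_unit_reducible (p k M : nat) : prime p -> (0 < M)%N ->
  (12 < p ^ k * p.+1)%N -> ~ unit_reducible (M * (p * p ^ k)).
Proof.
move=> p_pr M_gt0 kap_gt; set N := (M * (p * p ^ k))%N.
have p_gt0 := prime_gt0 p_pr.
have N_gt0 : (0 < N)%N by rewrite !muln_gt0 M_gt0 p_gt0 expn_gt0 p_gt0.
set z := zeta N; have z_prim : N.-primitive_root z := zeta_prim N_gt0.
have [zK DzK genz] := cyclo_gen N.
pose x : cyclo N := 1 - zK ^+ M; pose fx : {poly int} := 1 - 'X^M.
have evx (w : algC) : evZ w fx = 1 - w ^+ M by rewrite rmorphB rmorph1 /= evZXn.
have Dx : cyclo_incl N x = evZ z fx.
  by rewrite evx rmorphB rmorph1 rmorphXn /= DzK.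
have sub1_neq0 (w : algC) : N.-primitive_root w -> 1 - w ^+ M != 0.
  move=> w_prim; have [h Dp _] := Aint_div_sub1 p_pr w_prim.
  by apply: contra_eq_neq Dp => ->; rewrite mul0r pnatr_eq0 -lt0n.
have zj_prim (j : nat) : coprime j N -> N.-primitive_root (z ^+ j).
  by move=> co_j; rewrite prim_root_exp_coprime.
have x_neq0 : x != 0 by rewrite -(fmorph_eq0 (cyclo_incl N)) Dx evx sub1_neq0.
pose a := (x * cyclo_conj x)^-1.
have a_pos : totally_positive a.
  move=> sigma; rewrite fmorphV rmorphM /= cyclo_conj_embed // -normCK invr_gt0.
  by rewrite exprn_gt0 // normr_gt0 fmorph_eq0.
pose T f := psum N z (fun w => `|evZ w f| ^+ 2 / `|1 - w ^+ M| ^+ 2).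
have traceE y f : cyclo_incl N y = evZ z f -> ratr (trace_form a y) = T f.
  move=> Dy; apply: field_trace_psum => // u j co_j Du.
  have uE := cyclo_conj_embed (u \o cyclo_incl N) _ N_gt0.
  have uy g w : cyclo_incl N w = evZ z g -> u (cyclo_incl N w) = evZ (z ^+ j) g.
    by move=> ->; rewrite evZ_aut Du.
  rewrite !rmorphM fmorphV rmorphM /= fmorphV rmorphM.
  rewrite [u (cyclo_incl N (cyclo_conj x))]uE [u (cyclo_incl N (cyclo_conj y))]uE /=.
  by rewrite (uy fx) // (uy f) // -mulrA -!normCK evx mulrC.
have int1 : is_integer (1 : cyclo N) by exact: integral1.
have trace_x : ratr (trace_form a x) = (totient N)%:R :> algC.
  rewrite (traceE x fx Dx) /T -(psum1 N z); apply: eq_psum => j co_j.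
  by rewrite evx divff // expf_neq0 // normr_eq0 sub1_neq0 // zj_prim.
(* [p / (1 - w ^+ M)] is integral at every conjugate [w] of [z], so [p ^ 2] is a common denominator
   of the traces. *)
have trace_nat y : is_integer y ->
    exists n : nat, (p ^ 2)%:R * trace_form a y = n%:R.
  move=> /(cyclo_integerP N_gt0)[f Dy].
  have : (p ^ 2)%:R * ratr (trace_form a y) \in (Num.nat : {pred algC}).
    rewrite (traceE y f Dy) natrEint; apply/andP; split; last first.
      by rewrite mulr_ge0 // psum_ge0 // => j; rewrite divr_ge0 ?exprn_ge0.
    apply: Cint_rat_Aint.
      by rewrite -(traceE y f Dy) rpredM ?rpred_nat ?Crat_rat.
    rewrite /T /psum mulr_sumr rpred_sum // => j co_j; set w := z ^+ j.
    have [_ _ wA] := Aint_div_sub1 p_pr (zj_prim j co_j).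
    have -> : (p ^ 2)%:R * (`|evZ w f| ^+ 2 / `|1 - w ^+ M| ^+ 2) =
        `|p%:R / (1 - w ^+ M) * evZ w f| ^+ 2.
      by rewrite !normrM normfV normr_nat natrX !exprMn exprVn mulrAC mulrA.
    have vA : p%:R / (1 - w ^+ M) * evZ w f \in Aint.
      by rewrite rpredM // Aint_evZ // rpredX // (Aint_prim_root z_prim).
    by rewrite normCK rpredM // (Aint_aut Num.conj).
  move=> /natrP[n Dn]; exists n; apply: (fmorph_inj (ratr : {rmorphism rat -> algC})).
  by rewrite rmorphM /= !ratr_nat.
have zK_N : zK ^+ N = 1.
  apply: (fmorph_inj (cyclo_incl N)).
  by rewrite rmorphXn /= DzK (prim_expr_order z_prim) rmorph1.
have x_int : is_integer x.
  apply: integral_sub => //; exists ('X^N - 1); first by rewrite monicXnsubC.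
  by rewrite /root rmorphB rmorph1 /= map_polyXn !hornerE exprAC zK_N expr1n subrr.
move=> unit_red.
have p2_gt0 : (0 < p ^ 2)%N by rewrite expn_gt0 p_gt0.
apply: (is_min_exists (S := fun r => exists y,
  [/\ is_integer y, y != 0 & r = trace_form a y]) p2_gt0).
- by move=> r [y [y_int _ ->]]; apply: trace_nat.
- by exists (trace_form a x), x.
move=> [m min_m].
apply: (is_min_exists (S := fun r => exists u,
  is_unit_integer u /\ r = trace_form a u) p2_gt0).
- by move=> r [u [[u_int _] ->]]; apply: trace_nat.
- by exists (trace_form a 1), 1; split=> //; split=> //; exists 1; rewrite ?mulr1.
move=> [m' min_m'].
have Dm := unit_red a a_pos m m' min_m min_m'.
have le_m : m <= trace_form a x by apply: min_m.2; exists x.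
have [u [[u_int [v v_int uv]] Dm']] := min_m'.1.
have [f Du] := cyclo_integerP N_gt0 u_int.
(* If [1 - z ^+ M] divided the unit [u], multiplying the quotient by the inverse [v] would make
   [(1 - z ^+ M)^-1] integral. *)
have f_nA : ~~ (evZ z f / (1 - z ^+ M) \in Aint).
  apply: contra (inv_sub1_not_Aint p_pr z_prim) => fA.
  have -> : (1 - z ^+ M)^-1 = cyclo_incl N v * (evZ z f / (1 - z ^+ M)).
    by rewrite -Du mulrA -rmorphM mulrC [v * u]mulrC uv rmorph1 mulr1.
  by rewrite rpredM // cyclo_integer_Aint.
have := psum_ge p_pr z_prim f_nA.
rewrite -/N -/(T f) -(traceE u f Du) -Dm' -Dm => ge_m.
move: le_m; rewrite -(ler_rat algC) trace_x => /(le_trans ge_m).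
apply/negP; rewrite lt_geF // ltr_pMl ?ltr0n ?totient_gt0 //.
by rewrite ltr_pdivlMr // mul1r ltr_nat.
Qed.

Local Close Scope ring_scope.

Theorem corollary3p1 (N : nat) (N_gt0 : 0 < N)
    (N_div : 2 ^ 4 %| N \/ 3 ^ 3 %| N \/ 5 ^ 2 %| N \/ 7 ^ 2 %| N \/
             11 ^ 2 %| N \/ exists p : nat, [/\ prime p, 13 <= p & p %| N]) :
  ~ unit_reducible N.
Proof.
have red (p k : nat) : prime p -> 12 < p ^ k * p.+1 -> p ^ k.+1 %| N -> ~ unit_reducible N.
  move=> p_pr kap_gt /dvdnP[M DN]; move: N_gt0; rewrite DN expnS muln_gt0 => /andP[M_gt0 _].
  exact: not_unit_reducible.
(* The values of [p ^ k * p.+1] are at least 14 for [p >= 13], then 24, 36, 30, 56 and 132. For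
   [p = 11] and [k = 0] the value is exactly 12, hence the square of 11. *)
case: N_div => [|[|[|[|[|[p [p_pr p_ge p_N]]]]]]]; first 5 last.
- by apply: (red p 0) => //; rewrite ?expn1 // mul1n ltnS ltnW.
- exact: (red 2 3).
- exact: (red 3 2).
- exact: (red 5 1).
- exact: (red 7 1).
- exact: (red 11 1).
Qed.
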